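(* If we take the values $X_1,\ldots,X_n\sim\text{IID LPushBeta}(\alpha,\beta,\gamma,\phi)$ and we observe the corresponding sample vector $\boldsymbol{x}_n=(x_1,\ldots,x_n)$, then the resulting log-likelihood function is $$\ell_{\boldsymbol{x}_n}(\alpha,\beta,\gamma,\phi)=(\alpha-1)\sum_{i=1}^n\log(x_i)+(\beta-1)\sum_{i=1}^n\log(1-x_i)+\gamma\sum_{i=1}^n\log(1-x_i\phi)-\sum_{i=1}^n\log\left(\int_0^1 x^{\alpha-1}(1-x)^{\beta-1}(1-x\phi)^{\gamma}\,dx\right),$$ and the resulting partial derivatives in the score function are $$\frac{\partial\ell_{\boldsymbol{x}_n}}{\partial\alpha}(\alpha,\beta,\gamma,\phi)=\sum_{i=1}^n\log(x_i)-nL_1(\alpha,\beta,\gamma,\phi),$$ $$\frac{\partial\ell_{\boldsymbol{x}_n}}{\partial\beta}(\alpha,\beta,\gamma,\phi)=\sum_{i=1}^n\log(1-x_i)-nL_2(\alpha,\beta,\gamma,\phi),$$ $$\frac{\partial\ell_{\boldsymbol{x}_n}}{\partial\gamma}(\alpha,\beta,\gamma,\phi)=\sum_{i=1}^n\log(1-x_i\phi)-nL_3(\alpha,\beta,\gamma,\phi),$$ $$\frac{\partial\ell_{\boldsymbol{x}_n}}{\partial\phi}(\alpha,\beta,\gamma,\phi)=-\sum_{i=1}^n\frac{\gamma x_i}{1-x_i\phi}+n\gamma\cdot\frac{\mathrm{B}(\alpha,\beta)\;{}_2F_1(-\gamma,\alpha,\alpha+\beta;\phi)}{\mathrm{B}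(\alpha+1,\beta)\;{}_2F_1(-\gamma-1,\alpha+1,\alpha+\beta+1;\phi)}.$$
   Context: For $\alpha>0$, $\beta>0$, $\gamma\ge 0$, $0\le\phi\le 1$, the left-pushed beta distribution $\text{LPushBeta}(\alpha,\beta,\gamma,\phi)$ has density $$\text{LPushBeta}(x|\alpha,\beta,\gamma,\phi)=\frac{x^{\alpha-1}(1-x)^{\beta-1}(1-x\phi)^{\gamma}}{\int_0^1 t^{\alpha-1}(1-t)^{\beta-1}(1-t\phi)^{\gamma}\,dt},\qquad 0\le x\le 1.$$ Here $\mathrm{B}$ is the beta function and ${}_2F_1(a,b,c;z)$ is the Gaussian hypergeometric function with numerator parameters $a,b$, denominator parameter $c$ and argument $z$. The log-likelihood is $\ell_{\boldsymbol{x}_n}(\alpha,\beta,\gamma,\phi)=\sum_{i=1}^n\log\text{LPushBeta}(x_i|\alpha,\beta,\gamma,\phi)$. For $X_L\sim\text{LPushBeta}(\alpha,\beta,\gamma,\phi)$ define $$L_1(\alpha,\beta,\gamma,\phi)=\mathbb{E}(\log(X_L)),\quad L_2(\alpha,\beta,\gamma,\phi)=\mathbb{E}(\log(1-X_L)),\quad L_3(\alpha,\beta,\gamma,\phi)=\mathbb{E}(\log(1-X_L\phi)).$$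
   Formalization: The printed φ-derivative is false (e.g. at φ=0); its ratio is corrected to B(α+1,β)·2F1(1−γ,α+1,α+β+1;φ) / [B(α,β)·2F1(−γ,α,α+β;φ)]. The x_i lie in (0,1); boundary derivatives in γ, φ are one-sided, in φ possibly +∞. *)

(* Defs.v *)
From HB Require Import structures.
From mathcomp Require Import all_boot all_order all_algebra.
From mathcomp Require Import all_classical all_reals all_analysis.
Set Implicit Arguments.
Unset Strict Implicit.
Unset Printing Implicit Defensive.
Import Order.TTheory GRing.Theory Num.Theory.
Import numFieldNormedType.Exports.
Local Open Scope classical_set_scope.
Local Open Scope ring_scope.

Section special_functions.
Context {R : realType}.
Implicit Types a b c z : R.

(* The library's [beta_fun] only takes natural-number arguments. *)
Definition Beta a b : R :=
  \int[lebesgue_measure]_(t in `[0, 1]) (t `^ (a - 1) * (1 - t) `^ (b - 1)).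

Definition rising a (k : nat) : R := \prod_(i < k) (a + i%:R).

(* The Gauss series is summed in the extended reals: at [z = 1] it takes the
   value [+oo] when it diverges with eventually positive terms. *)
Definition hypergeo2F1 a b c z : \bar R :=
  (\sum_(0 <= k <oo)
     (rising a k * rising b k / rising c k * z ^+ k / k`!%:R)%:E)%E.

End special_functions.

Section left_pushed_beta.
Context {R : realType}.
Implicit Types (alpha beta gamma phi x : R).

Definition lpush_kernel alpha beta gamma phi x : R :=
  x `^ (alpha - 1) * (1 - x) `^ (beta - 1) * (1 - x * phi) `^ gamma.

Definition lpush_pdf alpha beta gamma phi x : R :=
  if 0 <= x <= 1 then
    lpush_kernel alpha beta gamma phi x /
    \int[lebesgue_measure]_(t in `[0, 1]) lpush_kernel alpha beta gamma phi t
  else 0.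

Definition lpush_distributed d (T : measurableType d) (P : probability T R)
    (X : {RV P >-> R}) alpha beta gamma phi : Prop :=
  forall A : set R, measurable A ->
    distribution P X A =
    (\int[lebesgue_measure]_(x in A) (lpush_pdf alpha beta gamma phi x)%:E)%E.

Definition mutually_independent d (T : measurableType d) (P : probability T R)
    (n : nat) (X : 'I_n -> {RV P >-> R}) : Prop :=
  forall (J : {set 'I_n}) (A : 'I_n -> set R),
    (forall i, measurable (A i)) ->
    P (\bigcap_(i in [set` J]) (X i @^-1` A i)) =
    (\prod_(i in J) P (X i @^-1` A i))%E.

Definition lpush_iid d (T : measurableType d) (P : probability T R)
    (n : nat) (X : 'I_n -> {RV P >-> R}) alpha beta gamma phi : Prop :=
  (forall i, lpush_distributed (X i) alpha beta gamma phi) /\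
  mutually_independent X.

Definition lpush_loglik (n : nat) (x : 'I_n -> R) alpha beta gamma phi : R :=
  \sum_(i < n) ln (lpush_pdf alpha beta gamma phi (x i)).

Definition lpush_L1 d (T : measurableType d) (P : probability T R)
  (X : {RV P >-> R}) : R := fine 'E_P[fun w => ln (X w)].

Definition lpush_L2 d (T : measurableType d) (P : probability T R)
  (X : {RV P >-> R}) : R := fine 'E_P[fun w => ln (1 - X w)].

Definition lpush_L3 d (T : measurableType d) (P : probability T R)
  (X : {RV P >-> R}) phi : R := fine 'E_P[fun w => ln (1 - X w * phi)].

End left_pushed_beta.

(* Derivative of [f] at [x] relative to [D]: the ordinary derivative when [x]
   is interior to [D], a one-sided one when [x] is an endpoint of the interval
   [D]. The limit is taken in the extended reals; a finite value [l%:E] means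
   convergence of the real difference quotients to [l]. *)
Definition has_derivative_in {R : realType} (D : set R) (f : R -> R) (x : R)
    (l : \bar R) : Prop :=
  ((f y - f x) / (y - x))%:E @[y --> within D x^'] --> l.

(* With Z(phi) = int_0^1 t^(alpha-1) (1-t)^(beta-1) (1-t phi)^gamma dt, Euler's
   integral gives
     Z(phi)  = Beta alpha beta * 2F1(-gamma, alpha; alpha+beta; phi),
     Z'(phi) = - gamma * Beta (alpha+1) beta
                 * 2F1(1-gamma, alpha+1; alpha+beta+1; phi),
   so the phi-score involves - n Z'/Z. The literature also prints this ratio
   upside down and with -gamma-1 in place of 1-gamma; that version is false:
   at phi = 0 it equals n gamma (alpha+beta)/alpha, whereas
   - n Z'(0)/Z(0) = n gamma alpha/(alpha+beta). *)

(* Main.v *)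
(* Write Z(alpha, beta, gamma, phi) for the normalizing integral, so that the
   log-likelihood is the explicit sum of logarithms minus n log Z.

   In alpha, beta and gamma the integrand has the form w(t) b(t)^s with
   0 < b <= 1. Since b^e |log b| <= 1/e, integrability at some s0 < s dominates
   the s-derivative near s, and differentiating under the integral sign gives
   dZ/ds / Z = E(log b).

   In phi the slopes of (1 - t phi)^gamma converge to
   - gamma t (1 - t phi)^(gamma - 1). The slope of Z converges by domination,
   except when phi = 1 and gamma < 1: there the limiting integral may diverge,
   but it bounds the slopes from above, so Fatou's lemma concludes.

   Both integrals left are Euler integrals: integrate the binomial series of
   (1 - t phi)^(-c) term by term, using B(a + 1, b) = a / (a + b) B(a, b). All
   coefficients are positive if c > 0; if c <= 0 their sign is eventually
   constant, which makes the partial sums uniformly bounded on [0, 1). *)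
Require Import Defs.
From HB Require Import structures.
From mathcomp Require Import all_boot all_order all_algebra.
From mathcomp Require Import all_classical all_reals all_analysis.
From mathcomp Require Import measurable_realfun.
From mathcomp Require Import ring lra.
Set Implicit Arguments.
Unset Strict Implicit.
Unset Printing Implicit Defensive.
Import Order.TTheory GRing.Theory Num.Theory.
Import numFieldNormedType.Exports.
Local Open Scope classical_set_scope.
Local Open Scope ring_scope.
Local Notation mu := lebesgue_measure.

(** * The beta integral *)

(** [f] may be unbounded at both ends: the theorem on closed intervals is applied to
    [[a + c n, b - c n]], and monotone convergence lets these intervals fill []a, b[]. *)
Lemma ge0_FTC2_oo {R : realType} (f F : R -> R) (a b : R) : a < b ->
  {within `[a, b], continuous F} ->
  (forall x, x \in `]a, b[ -> is_derive x 1 F (f x)) ->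
  {in `]a, b[, continuous f} ->
  (forall x, x \in `]a, b[ -> 0 <= f x) ->
  (\int[mu]_(x in `]a, b[) (f x)%:E = (F b - F a)%:E)%E.
Proof.
move=> ab cF dF cf f0.
(* The shift by 2 gives [c n <= (b - a) / 3], so the two ends of [I n] never cross. *)
pose c (n : nat) : R := (b - a) * harmonic (n + 2)%N.
have c_gt0 n : 0 < c n by rewrite mulr_gt0 ?subr_gt0 ?harmonic_gt0.
have c0 : c n @[n --> \oo] --> 0.
  rewrite -[X in _ --> X](mulr0 (b - a)); apply: cvgMl_tmp.
  by rewrite (cvg_shiftn 2); exact: cvg_harmonic.
have c_lt n : a + c n < b - c n.
  suff : c n <= (b - a) / 3 by have := ab; lra.
  rewrite ler_pM2l ?subr_gt0// lef_pV2 ?posrE// ?ltr0n// ler_nat.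
  by rewrite addn2 ltnS.
pose I (n : nat) : set R := `[a + c n, b - c n]%classic.
have Ioo n : I n `<=` `]a, b[.
  move=> x; rewrite /I /= !in_itv/= => /andP[h1 h2].
  by have := c_gt0 n; lra.
have Icup : \bigcup_n I n = `]a, b[%classic.
  apply/seteqP; split=> [x [n _ /Ioo]//|x].
  rewrite /= in_itv/= => /andP[ax xb].
  have e0 : 0 < Num.min (x - a) (b - x) by rewrite lt_min !subr_gt0 ax.
  have /cvgrPdist_lt /(_ _ e0) [N _ /(_ _ (leqnn N))] := c0.
  rewrite sub0r normrN gtr0_norm// lt_min => /andP[h1 h2].
  by exists N => //; rewrite /I /= in_itv/=; apply/andP; split; lra.
have mf : measurable_fun (`]a, b[ : set R) (EFin \o f).
  apply/measurable_EFinP; apply: open_continuous_measurable_fun => //.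
  by move=> x; rewrite inE; exact: cf.
have [_ Fa Fb] := (continuous_within_itvP _ ab).1 cF.
have Ic : (\int[mu]_(x in I n) (f x)%:E)%E @[n --> \oo] -->
    (\int[mu]_(x in \bigcup_i I i) (f x)%:E)%E.
  apply: ge0_nondecreasing_set_cvg_integral.
  - apply/nondecreasing_seqP => n; rewrite subsetEset /I.
    have cc : c n.+1 <= c n.
      rewrite ler_pM2l ?subr_gt0// lef_pV2 ?posrE// ?ltr0n// ler_nat.
      by rewrite addSn.
    by apply: subset_itv; rewrite bnd_simp; lra.
  - by move=> n; exact: measurable_itv.
  - by move=> n; apply: measurable_funS (Ioo n) mf.
  - by move=> n x /Ioo /f0; rewrite lee_fin.
rewrite -Icup; suff : (\int[mu]_(x in I n) (f x)%:E)%E @[n --> \oo] -->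
    (F b - F a)%:E by move=> L; apply: (cvg_unique _ Ic L).
have -> : (fun n => \int[mu]_(x in I n) (f x)%:E)%E =
    (fun n => (F (b - c n) - F (a + c n))%:E).
  apply/funext => n; rewrite /I (@continuous_FTC2 _ f F)//.
  - apply: continuous_in_subspaceT => x; rewrite inE => /Ioo.
    exact: cf.
  - have dd x : x \in `[a + c n, b - c n] -> derivable F x 1.
      by move=> /Ioo/dF[].
    have : {within `[a + c n, b - c n], continuous F}.
      exact: derivable_within_continuous.
    move/(continuous_within_itvP _ (c_lt n)) => [_ h1 h2]; split => // x.
    by move=> xI; apply: dd; apply: subset_itv_oo_cc.
  - move=> x xI; rewrite derive1E.
    have /dF[] // : x \in `]a, b[.
    by apply: (Ioo n); rewrite /I /=; exact: subset_itv_oo_cc.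
apply: cvg_EFin; first exact: nearW.
apply: cvgB.
- move/cvg_at_leftP : Fb; apply; split=> [n|]; first by have := c_gt0 n; lra.
  by rewrite -[X in _ --> X](subr0 b); apply: cvgB => //; exact: cvg_cst.
- move/cvg_at_rightP : Fa; apply; split=> [n|]; first by have := c_gt0 n; lra.
  by rewrite -[X in _ --> X](addr0 a); apply: cvgD => //; exact: cvg_cst.
Qed.

(** A power is monotone in a positive base, so one of the two end values bounds it; adding both
    spares a case on the sign of [s]. *)
Lemma powR_le_ends {R : realType} (c d x s : R) : 0 < c -> c <= x <= d ->
  x `^ s <= c `^ s + d `^ s.
Proof.
move=> c0 /andP[cx xd]; have x0 : 0 < x by exact: lt_le_trans cx.
have [s0|s0] := leP 0 s.
  rewrite -[leLHS]add0r lerD ?powR_ge0// ge0_ler_powR// nnegrE ltW//.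
  exact: lt_le_trans xd.
rewrite -[leLHS]addr0 lerD ?powR_ge0// -(opprK s) powRN [leRHS]powRN.
rewrite lef_pV2 ?posrE ?powR_gt0//.
by rewrite ge0_ler_powR// ?nnegrE ?oppr_ge0 ltW.
Qed.

Lemma is_derive_powR_affine {R : realType} (p g x : R) : 0 < 1 - x * p ->
  is_derive x 1 (fun t : R => (1 - t * p) `^ g) (- (g * p * (1 - x * p) `^ (g - 1))).
Proof.
move=> h.
have h1 : is_derive x 1 (fun t : R => 1 - t * p) (- p).
  by apply: is_derive_eq; rewrite /GRing.scale/= ; ring.
have := @is_derive1_comp _ (@powR R ^~ g) (fun t => 1 - t * p) x _ _
  (is_derive1_powR g h) h1.
by congr is_derive; ring.
Qed.

Lemma derivable1_continuous {R : realType} (f : R -> R) (x : R) :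
  derivable f x 1 -> {for x, continuous f}.
Proof. by move=> /derivable1_diffP/differentiable_continuous. Qed.

Lemma is_derive_onem_powR {R : realType} (g x : R) : x < 1 ->
  is_derive x 1 (fun t : R => (1 - t) `^ g) (- (g * (1 - x) `^ (g - 1))).
Proof.
move=> x1; have := @is_derive_powR_affine R 1 g x.
rewrite !mulr1 subr_gt0 => /(_ x1).
by congr is_derive; apply/funext => t; rewrite mulr1.
Qed.

Lemma powR_within_continuous01 {R : realType} (a : R) : 0 < a ->
  {within `[0, 1], continuous (fun t : R => t `^ a)}.
Proof.
move=> a0; apply/(continuous_within_itvP _ ltr01); split.
- move=> x; rewrite in_itv/= => /andP[x0 _].
  by apply: derivable1_continuous; have [] := is_derive1_powR a x0.
- by rewrite powR0 ?gt_eqF//; exact: powR_cvg0.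
- apply: cvg_at_left_filter; apply: (@derivable1_continuous _ (@powR R ^~ a)).
  by have [] := is_derive1_powR a (@ltr01 R).
Qed.

Lemma onem_powR_within_continuous01 {R : realType} (a : R) : 0 < a ->
  {within `[0, 1], continuous (fun t : R => (1 - t) `^ a)}.
Proof.
move=> a0; apply/(continuous_within_itvP _ ltr01); split.
- move=> x; rewrite in_itv/= => /andP[_ x1].
  by apply: derivable1_continuous; have [] := is_derive_onem_powR a x1.
- apply: cvg_at_right_filter.
  apply: (@derivable1_continuous _ (fun t : R => (1 - t) `^ a)).
  by have [] := is_derive_onem_powR a (@ltr01 R).
(* In the variable 1 - t the left limit at 1 is the right limit of the power at 0. *)
- rewrite subrr powR0 ?gt_eqF//; apply/cvg_at_leftP => u [u1 cu].
  have /cvg_at_rightP := powR_cvg0 a0; apply; split=> [n|].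
    by rewrite subr_gt0.
  by rewrite -[X in _ --> X](subrr (1:R)); apply: cvgB => //; exact: cvg_cst.
Qed.

(** The antiderivative t^a / a is continuous up to 0 even where the integrand blows up, so the
    integral is finite. *)
Lemma integrable_powR01 {R : realType} (a : R) : 0 < a ->
  mu.-integrable `]0, 1[ (EFin \o (fun t : R => t `^ (a - 1))).
Proof.
move=> a0; apply/integrableP; split.
  by apply/measurable_EFinP; apply: measurable_funTS; exact: measurable_powR.
under eq_integral do rewrite /= ger0_norm ?powR_ge0//.
have cF : {within `[0, 1], continuous (fun t : R => t `^ a / a)}.
  by move=> x; apply: cvgMr_tmp; exact: (powR_within_continuous01 a0).
have dF (x : R) : x \in `]0, 1[ ->
    is_derive x 1 (fun t : R => t `^ a / a) (x `^ (a - 1)).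
  rewrite in_itv/= => /andP[x0 _].
  have h := is_derive1_powR a x0.
  by apply: is_derive_eq; rewrite /GRing.scale/=; field; rewrite gt_eqF.
rewrite (ge0_FTC2_oo (@ltr01 R) cF dF) ?ltry//.
- move=> x; rewrite in_itv/= => /andP[x0 _].
  by apply: derivable1_continuous; have [] := is_derive1_powR (a - 1) x0.
- by move=> x _; exact: powR_ge0.
Qed.

Lemma integrable_onem_powR01 {R : realType} (b : R) : 0 < b ->
  mu.-integrable `]0, 1[ (EFin \o (fun t : R => (1 - t) `^ (b - 1))).
Proof.
move=> b0; apply/integrableP; split.
  apply/measurable_EFinP; apply: measurable_funTS.
  apply: (measurableT_comp (measurable_powR _)).
  exact: measurable_funB.
under eq_integral do rewrite /= ger0_norm ?powR_ge0//.
have cF : {within `[0, 1], continuous (fun t : R => - ((1 - t) `^ b / b))}.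
  move=> x; apply: cvgN; apply: cvgMr_tmp.
  exact: (onem_powR_within_continuous01 b0).
have dF (x : R) : x \in `]0, 1[ ->
    is_derive x 1 (fun t : R => - ((1 - t) `^ b / b)) ((1 - x) `^ (b - 1)).
  rewrite in_itv/= => /andP[_ x1].
  have h := is_derive_onem_powR b x1.
  by apply: is_derive_eq; rewrite /GRing.scale/=; field; rewrite gt_eqF.
rewrite (ge0_FTC2_oo (@ltr01 R) cF dF) ?ltry//.
- move=> x; rewrite in_itv/= => /andP[_ x1].
  by apply: derivable1_continuous; have [] := is_derive_onem_powR (b - 1) x1.
- by move=> x _; exact: powR_ge0.
Qed.

Definition beta_kernel {R : realType} (a b t : R) : R :=
  t `^ (a - 1) * (1 - t) `^ (b - 1).

Lemma beta_kernel_ge0 {R : realType} (a b t : R) : 0 <= beta_kernel a b t.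
Proof. by rewrite mulr_ge0 ?powR_ge0. Qed.

Lemma beta_kernel_gt0 {R : realType} (a b t : R) : 0 < t < 1 ->
  0 < beta_kernel a b t.
Proof. by case/andP=> t0 t1; rewrite mulr_gt0 ?powR_gt0 ?subr_gt0. Qed.

Lemma measurable_powR_affine {R : realType} (p g : R) (D : set R) :
  measurable_fun D (fun t : R => (1 - t * p) `^ g).
Proof.
apply: measurable_funTS; apply: (measurableT_comp (measurable_powR _)).
by apply: measurable_funB => //; exact: measurable_funM.
Qed.

Lemma measurable_beta_kernel {R : realType} (a b : R) (D : set R) :
  measurable_fun D (beta_kernel a b).
Proof.
apply: measurable_funM.
  by apply: measurable_funTS; exact: measurable_powR.
have := @measurable_powR_affine R 1 (b - 1) D.
by under eq_fun do rewrite mulr1.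
Qed.

(** On each half of the interval only one factor can be singular; the other one is bounded by a
    constant. *)
Lemma integrable_beta_kernel {R : realType} (a b : R) : 0 < a -> 0 < b ->
  mu.-integrable `]0, 1[ (EFin \o beta_kernel a b).
Proof.
move=> a0 b0.
(* Each power of 1/2, together with 1, bounds one factor on the half where it is regular. *)
pose C : R := 1 + 2^-1 `^ (a - 1) + 2^-1 `^ (b - 1).
have i1 := integrable_powR01 a0.
have i2 := integrable_onem_powR01 b0.
have i3 : mu.-integrable `]0, 1[
    (fun t : R => C%:E * ((t `^ (a - 1))%:E + ((1 - t) `^ (b - 1))%:E))%E.
  by apply: integrableZl => //; apply: integrableD.
apply: le_integrable i3 => //.
  by apply/measurable_EFinP; exact: measurable_beta_kernel.
move=> t; rewrite /= in_itv/= => /andP[t0 t1].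
have A := powR_ge0 t (a - 1); have B := powR_ge0 (1 - t) (b - 1).
have P := powR_ge0 (2^-1 : R) (a - 1); have Q := powR_ge0 (2^-1 : R) (b - 1).
have C0 : 0 <= C by rewrite /C; lra.
rewrite lee_fin ger0_norm ?beta_kernel_ge0// ger0_norm; last first.
  by rewrite mulr_ge0// addr_ge0.
rewrite /beta_kernel; have [th|th] := leP t 2^-1.
  have : (1 - t) `^ (b - 1) <= 2^-1 `^ (b - 1) + 1 `^ (b - 1).
    by apply: powR_le_ends; lra.
  rewrite powR1 => h; rewrite mulrDr ler_wpDr// ?mulr_ge0//.
  by rewrite mulrC ler_wpM2r// /C; lra.
have : t `^ (a - 1) <= 2^-1 `^ (a - 1) + 1 `^ (a - 1).
  by apply: powR_le_ends; lra.
rewrite powR1 => h; rewrite mulrDr ler_wpDl// ?mulr_ge0//.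
by rewrite ler_wpM2r// /C; lra.
Qed.

(** The end points form a null set, and on the open interval no power of 0 occurs. *)
Lemma BetaE {R : realType} (a b : R) :
  Beta a b = \int[mu]_(t in `]0%R, 1%R[) beta_kernel a b t.
Proof.
rewrite /Beta /Rintegral integral_itv_bndoo//.
by apply/measurable_EFinP; exact: measurable_beta_kernel.
Qed.

Lemma integral_beta_kernel {R : realType} (a b : R) : 0 < a -> 0 < b ->
  (\int[mu]_(t in `]0%R, 1%R[) (beta_kernel a b t)%:E = (Beta a b)%:E)%E.
Proof.
move=> a0 b0; rewrite BetaE /Rintegral fineK//.
by apply: integrable_fin_num => //; exact: integrable_beta_kernel.
Qed.

(** If the integral vanished, [f] would be 0 almost everywhere on an interval of measure 1 on which
    it is positive. *)
Lemma Rintegral_gt0 {R : realType} (f : R -> R) :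
  mu.-integrable `]0, 1[ (EFin \o f) -> (forall t, 0 < t < 1 -> 0 < f t) ->
  0 < \int[mu]_(t in `]0%R, 1%R[) f t.
Proof.
move=> intf f0; rewrite lt_neqAle Rintegral_ge0 ?andbT; last first.
  by move=> t; rewrite /= in_itv/= => /f0/ltW.
apply/eqP => I0'.
have I0 : (\int[mu]_(t in `]0%R, 1%R[) (f t)%:E = 0)%E.
  by rewrite -[LHS]fineK; [congr EFin; exact/esym|exact: integrable_fin_num].
have mf : measurable_fun (`]0, 1[ : set R) (EFin \o f) by case/integrableP: intf.
have : (\int[mu]_(t in `]0%R, 1%R[) `|(f t)%:E| = 0)%E.
  rewrite -[RHS]I0; apply: eq_integral => t; rewrite inE /= in_itv/= => /f0 h.
  by rewrite gtr0_norm.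
move/(ae_eq_integral_abs mu (measurable_itv _) mf) => [N [mN N0 sub]].
have : (mu (`]0%R, 1%R[ : set R) <= mu N)%E.
  apply: le_measure; rewrite ?inE//.
  move=> t; rewrite /= in_itv/= => t01; apply: sub => /= /(_ _).
  rewrite in_itv/= => /(_ t01) [] h; have := f0 _ t01.
  by rewrite h ltxx.
rewrite N0 lebesgue_measure_itv/= lte_fin ltr01.
by rewrite -EFinB lee_fin subr0 ler10.
Qed.

Lemma Beta_gt0 {R : realType} (a b : R) : 0 < a -> 0 < b -> 0 < Beta a b.
Proof.
move=> a0 b0; rewrite BetaE; apply: Rintegral_gt0.
  exact: integrable_beta_kernel.
by move=> t; exact: beta_kernel_gt0.
Qed.

(* The derivative of t^a (1 - t)^b changes sign only at a / (a + b), so the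
   two halves of its integral are both given by the nonnegative FTC. *)
Lemma Beta_recurrence {R : realType} (a b : R) : 0 < a -> 0 < b ->
  Beta (a + 1) b = a / (a + b) * Beta a b.
Proof.
move=> a0 b0; have ab0 : 0 < a + b by rewrite addr_gt0.
pose F (t : R) := t `^ a * (1 - t) `^ b.
pose f (t : R) := a * beta_kernel a b t - (a + b) * beta_kernel (a + 1) b t.
pose c := a / (a + b).
have c0 : 0 < c by rewrite divr_gt0.
have c1 : c < 1 by rewrite ltr_pdivrMr// mul1r ltrDl.
have cF : {within `[0, 1], continuous F}.
  move=> x; apply: cvgM; first exact: (powR_within_continuous01 a0).
  exact: (onem_powR_within_continuous01 b0).
have fE (t : R) : 0 < t -> f t = (a - (a + b) * t) * beta_kernel a b t.
  move=> t0; rewrite /f /beta_kernel addrK -[t `^ a](@mulr_powRB1 _ _ a) ?ltW//.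
  by ring.
have dF (x : R) : x \in `]0, 1[ -> is_derive x 1 F (f x).
  rewrite in_itv/= => /andP[x0 x1].
  have h1 := is_derive1_powR a x0; have h2 := is_derive_onem_powR b x1.
  apply: is_derive_eq; rewrite /GRing.scale/= fE// /beta_kernel.
  rewrite -[(1 - x) `^ b](@mulr_powRB1 _ _ b) ?subr_ge0 ?ltW//.
  by rewrite -[x `^ a](@mulr_powRB1 _ _ a) ?ltW//; ring.
have ck (s : R) : {in `]0, 1[, continuous (beta_kernel s b)}.
  move=> x; rewrite in_itv/= => /andP[x0 x1].
  have h1 := is_derive1_powR (s - 1) x0.
  have h2 := is_derive_onem_powR (b - 1) x1.
  by apply: derivable1_continuous; apply: derivableM; [case: h1|case: h2].
have cf : {in `]0, 1[, continuous f}.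
  move=> x x01; apply: cvgB; apply: cvgMl_tmp; exact: ck.
have sub1 : `]0, c[ `<=` `]0, 1[ by apply: subset_itvl; rewrite bnd_simp ltW.
have sub2 : `]c, 1[ `<=` `]0, 1[ by apply: subset_itvr; rewrite bnd_simp ltW.
have F0 : F 0 = 0 by rewrite /F powR0 ?mul0r// gt_eqF.
have F1 : F 1 = 0 by rewrite /F subrr [X in _ * X]powR0 ?mulr0// gt_eqF.
have I1 : (\int[mu]_(x in `]0%R, c[) (f x)%:E = (F c)%:E)%E.
  have cF1 : {within `[0, c], continuous F}.
    by apply: continuous_subspaceW cF; apply: subset_itvl; rewrite bnd_simp ltW.
  have dF1 x : x \in `]0, c[ -> is_derive x 1 F (f x) by move=> /sub1; exact: dF.
  rewrite (ge0_FTC2_oo c0 cF1 dF1) ?F0 ?subr0//.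
  - by move=> x /sub1; exact: cf.
  - move=> x; rewrite in_itv/= => /andP[x0 xc]; rewrite fE//.
    rewrite mulr_ge0 ?beta_kernel_ge0// subr_ge0 mulrC -ler_pdivlMr//.
    exact: ltW.
have I2 : (\int[mu]_(x in `]c, 1%R[) (- f x)%:E = (F c)%:E)%E.
  have cF2 : {within `[c, 1], continuous (fun x => - F x)}.
    have cF2 : {within `[c, 1], continuous F}.
      by apply: continuous_subspaceW cF; apply: subset_itvr; rewrite bnd_simp ltW.
    by move=> x; apply: cvgN; exact: cF2.
  have dF2 x : x \in `]c, 1[ -> is_derive x 1 (fun x => - F x) (- f x).
    by move=> /sub2/dF h; exact: is_deriveN.
  rewrite (ge0_FTC2_oo c1 cF2 dF2) ?F1 ?oppr0 ?sub0r ?opprK//.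
  - by move=> x /sub2 h; apply: cvgN; exact: cf.
  - move=> x; rewrite in_itv/= => /andP[cx x1]; rewrite fE ?(lt_trans c0)//.
    rewrite -mulNr mulr_ge0 ?beta_kernel_ge0// opprB subr_ge0 mulrC.
    by rewrite -ler_pdivrMr//; exact: ltW.
have a10 : 0 < a + 1 by rewrite addr_gt0.
have if1 : mu.-integrable `]0, 1[ (EFin \o (fun t => a * beta_kernel a b t)).
  under [X in _.-integrable _ X]eq_fun do rewrite /= EFinM.
  by apply: integrableZl => //; exact: integrable_beta_kernel.
have if2 : mu.-integrable `]0, 1[
    (EFin \o (fun t => (a + b) * beta_kernel (a + 1) b t)).
  under [X in _.-integrable _ X]eq_fun do rewrite /= EFinM.
  by apply: integrableZl => //; exact: integrable_beta_kernel.
have If : mu.-integrable `]0, 1[ (EFin \o f).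
  under [X in _.-integrable _ X]eq_fun do rewrite /= EFinB.
  exact: integrableB.
(* The two halves contribute [F c] and [- F c]; linearity then turns the vanishing integral of [f]
   into the recurrence. *)
have : \int[mu]_(x in `]0%R, 1%R[) f x = 0.
  have := @Rintegral_itvB _ f (BRight 0) (BLeft 1) c If.
  rewrite !bnd_simp => /(_ (ltW c0) c1)/eqP.
  rewrite subr_eq => /eqP ->.
  rewrite -Rintegral_itv_bndo_bndc; last exact: integrableS If.
  have -> : \int[mu]_(x in `]0%R, c[) f x = F c by rewrite /Rintegral I1.
  have I2' : \int[mu]_(x in `]c, 1%R[) (- f x) = F c by rewrite /Rintegral I2.
  rewrite -I2' -RintegralD//; [|exact: integrableS If|].
    by under eq_Rintegral do rewrite subrr; rewrite Rintegral_cst// mul0r.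
  have /integrableN : mu.-integrable `]c, 1[ (EFin \o f) by exact: integrableS If.
  exact.
rewrite RintegralB// !RintegralZl//; [|exact: integrable_beta_kernel..].
rewrite -!BetaE => /eqP; rewrite subr_eq0 => /eqP h.
by rewrite mulrAC h mulrAC mulfV ?mul1r// gt_eqF.
Qed.

(** * The binomial series and Euler's integral *)

Lemma mulr_powR_pred {R : realType} (x s : R) : 0 < x ->
  x * x `^ (s - 1) = x `^ s.
Proof.
move=> x0; rewrite -{1}(powRr1 (ltW x0)) -powRD ?subrKC//.
by apply/implyP => _; rewrite gt_eqF.
Qed.

(** The coefficient of z^k in the expansion of (1 - z)^(-a). *)
Definition binom_coef {R : realType} (a : R) (k : nat) : R :=
  rising a k / k`!%:R.

Lemma risingS {R : realType} (a : R) k : rising a k.+1 = rising a k * (a + k%:R).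
Proof. by rewrite /rising big_ord_recr. Qed.

Lemma rising0 {R : realType} (a : R) : rising a 0 = 1.
Proof. by rewrite /rising big_ord0. Qed.

Lemma rising_gt0 {R : realType} (a : R) k : 0 < a -> 0 < rising a k.
Proof. by move=> a0; apply: prodr_gt0 => i _; rewrite ltr_wpDr. Qed.

Lemma binom_coefS {R : realType} (a : R) k :
  k.+1%:R * binom_coef a k.+1 = (a + k%:R) * binom_coef a k.
Proof.
rewrite /binom_coef risingS factS natrM.
have : k`!%:R != 0 :> R by rewrite pnatr_eq0 -lt0n fact_gt0.
have : k.+1%:R != 0 :> R by rewrite pnatr_eq0.
move: (k.+1%:R) (k`!%:R) => s f s0 f0.
by field; rewrite s0 f0.
Qed.

Definition binom_sum {R : realType} (a : R) (n : nat) (z : R) : R :=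
  \sum_(0 <= k < n) binom_coef a k * z ^+ k.

Lemma binom_sumS_at0 {R : realType} (a : R) n : binom_sum a n.+1 0 = 1.
Proof.
rewrite /binom_sum big_nat_recl// big1_seq ?addr0.
  by rewrite /binom_coef rising0 fact0 expr0 mul1r invr1 mulr1.
by move=> k _; rewrite expr0n mulr0.
Qed.

(** At k = 0 the truncated exponent [k.-1] is harmless, because the factor k vanishes. *)
Lemma is_derive_binom_sum {R : realType} (a : R) n (z : R) :
  is_derive z 1 (binom_sum a n)
    (\sum_(0 <= k < n) binom_coef a k * (k%:R * z ^+ k.-1)).
Proof.
elim: n => [|n IH].
  rewrite big_nil (_ : binom_sum a 0 = cst 0); first exact: is_derive_cst.
  by apply/funext => x; rewrite /binom_sum big_nil.
rewrite big_nat_recr//= (_ : binom_sum a n.+1 =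
   (fun x => binom_sum a n x + binom_coef a n * x ^+ n)); last first.
  by apply/funext => x; rewrite /binom_sum big_nat_recr.
have h : is_derive z 1 (fun x => binom_coef a n * x ^+ n)
    (binom_coef a n * (n%:R * z ^+ n.-1)).
  rewrite (_ : (fun x => _) = binom_coef a n *: (@id R ^+ n)); last first.
    by apply/funext => x; rewrite !fctE.
  apply: is_deriveZ; apply: is_derive_eq.
  by rewrite /GRing.scale/= mulr1.
exact: is_deriveD.
Qed.

(** The full series y solves (1 - z) y' = a y; by the recurrence of the coefficients, truncation
    leaves only a last term. *)
Lemma binom_sum_ode {R : realType} (a : R) n (z : R) :
  (1 - z) * (\sum_(0 <= k < n) binom_coef a k * (k%:R * z ^+ k.-1)) -
    a * binom_sum a n z = - (n%:R * binom_coef a n * z ^+ n.-1).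
Proof.
elim: n => [|n IH]; first by rewrite /binom_sum !big_nil !(mul0r, mulr0) subr0 oppr0.
rewrite binom_coefS /binom_sum !big_nat_recr//= -/(binom_sum a n z).
rewrite [LHS](_ : _ = (1 - z) *
  (\sum_(0 <= k < n) binom_coef a k * (k%:R * z ^+ k.-1)) - a * binom_sum a n z +
  (1 - z) * (binom_coef a n * (n%:R * z ^+ n.-1)) - a * (binom_coef a n * z ^+ n)).
  by rewrite IH; case: n {IH} => [|n] /=; rewrite ?exprS; ring.
by ring.
Qed.

(** Ratio test: consecutive terms have ratio z (a + n) / n, which tends to z < 1. *)
Lemma cvg_binom_coef {R : realType} (a z : R) : 0 <= z < 1 ->
  n%:R * binom_coef a n * z ^+ n @[n --> \oo] --> (0 : R).
Proof.
move=> /andP[z0 z1].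
pose u n := n%:R * binom_coef a n * z ^+ n.
pose r := (1 + z) / 2.
have r1 : `|r| < 1 by rewrite ger0_norm /r; lra.
have r0 : 0 <= r by rewrite /r; lra.
(* For n > N this gives (|a| + n) z <= r n, that is, a ratio of at most [r], the midpoint of z and
   1. *)
have [N hN] : exists N : nat, `|a| * z <= N.+1%:R * ((1 - z) / 2).
  exists (Num.truncn (`|a| * z / ((1 - z) / 2))).
  rewrite -ler_pdivrMr; last by lra.
  by apply/ltW; apply: truncnS_gt.
have step n : (N < n)%N -> `|u n.+1| <= r * `|u n|.
  move=> Nn; have n0 : 0 < n%:R :> R by rewrite ltr0n (leq_ltn_trans _ Nn).
  rewrite /u binom_coefS exprS.
  have -> : (a + n%:R) * binom_coef a n * (z * z ^+ n) =
    ((a + n%:R) / n%:R * z) * (n%:R * binom_coef a n * z ^+ n).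
    by field; rewrite gt_eqF.
  rewrite normrM ler_wpM2r// normrM normf_div (ger0_norm z0) (gtr0_norm n0).
  rewrite mulrAC ler_pdivrMr//.
  have h1 : `|a + n%:R| <= `|a| + n%:R.
    by rewrite (le_trans (ler_normD _ _))// (gtr0_norm n0).
  apply: (le_trans (ler_wpM2r z0 h1)).
  have h2 : N.+1%:R <= n%:R :> R by rewrite ler_nat.
  have h3 : N.+1%:R * ((1 - z) / 2) <= n%:R * ((1 - z) / 2).
    by rewrite ler_wpM2r//; lra.
  by rewrite /r; nra.
have bound j : `|u (j + N.+1)%N| <= r ^+ j * `|u N.+1|.
  elim: j => [|j IH]; first by rewrite add0n expr0 mul1r.
  rewrite addSn (le_trans (step _ _)) ?ltn_addl//.
  by rewrite exprS -mulrA ler_wpM2l.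
apply/norm_cvg0P; rewrite -(cvg_shiftn N.+1) /=.
apply: (@squeeze_cvgr _ _ _ _ (fun=> 0) (fun j => r ^+ j * `|u N.+1|)).
- by apply: nearW => j; rewrite normr_ge0 bound.
- exact: cvg_cst.
- rewrite -[X in _ --> X](mul0r `|u N.+1|); apply: cvgMr_tmp.
  exact: cvg_expr.
Qed.

(* G = (1 - z)^a S_n(z) satisfies G' = - n c_n z^(n-1) (1 - z)^(a-1), so the
   mean value theorem turns decay of n c_n z^n into convergence of S_n. *)
Lemma cvg_binom_sum {R : realType} (a z : R) : 0 <= z < 1 ->
  binom_sum a n z @[n --> \oo] --> (1 - z) `^ (- a).
Proof.
move=> z01; have /andP[z0 z1] := z01.
(* Multiplying by (1 - z)^a makes the expected limit the constant 1, the value of [G] at 0. *)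
suff h : (1 - z) `^ a * binom_sum a n z @[n --> \oo] --> (1 : R).
  rewrite -[X in _ --> X]mulr1 (_ : (fun n => _) =
      (fun n => (1 - z) `^ (- a) * ((1 - z) `^ a * binom_sum a n z))).
    exact: cvgMl_tmp.
  apply/funext => n; rewrite mulrA -powRD ?addNr ?powRr0 ?mul1r//.
  by apply/implyP => _; rewrite subr_eq0 gt_eqF.
(* The mean value theorem below needs a nondegenerate interval [0, z]. *)
have [->|zneq0] := eqVneq z 0.
  rewrite -(cvg_shiftS (fun n => (1 - 0) `^ a * binom_sum a n 0)).
  rewrite (_ : (fun n => _) = fun=> 1); first exact: cvg_cst.
  by apply/funext => n /=; rewrite subr0 powR1 mul1r binom_sumS_at0.
have zgt0 : 0 < z by rewrite lt_neqAle eq_sym zneq0.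
(* [M] bounds (1 - c)^(a - 1) for every c between 0 and z, whatever the sign of the exponent. *)
pose M := (1 - z) `^ (a - 1) + 1.
have M0 : 0 <= M by rewrite addr_ge0 ?powR_ge0.
pose G n (t : R) := (1 - t) `^ a * binom_sum a n t.
have dG n (t : R) : t < 1 -> is_derive t 1 (G n)
    (- (n%:R * binom_coef a n * t ^+ n.-1) * (1 - t) `^ (a - 1)).
  move=> t1; have h1 := is_derive_onem_powR a t1.
  have h2 := is_derive_binom_sum a n t.
  apply: is_derive_eq; rewrite /GRing.scale/= -binom_sum_ode.
  by rewrite -[(1 - t) `^ a](mulr_powR_pred a) ?subr_gt0//; ring.
have G0 n : G n.+1 0 = 1.
  by rewrite /G subr0 powR1 mul1r binom_sumS_at0.
have bound n : `|G n.+1 z - 1| <= M * `|n.+1%:R * binom_coef a n.+1 * z ^+ n.+1|.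
  have [c cI] : exists2 c, c \in `]0, z[ & G n.+1 z - G n.+1 0 =
      (- (n.+1%:R * binom_coef a n.+1 * c ^+ n.+1.-1) * (1 - c) `^ (a - 1)) * (z - 0).
    apply: MVT => //.
      by move=> x; rewrite in_itv/= => /andP[_ xz]; apply: dG; exact: lt_trans z1.
    apply: derivable_within_continuous => x; rewrite in_itv/= => /andP[_ xz].
    by have [] := dG n.+1 x (le_lt_trans xz z1).
  rewrite G0 subr0 => ->.
  move: cI; rewrite in_itv/= => /andP[c0 cz].
  rewrite mulNr mulNr normrN mulrAC mulrC normrM ger0_norm ?powR_ge0//.
  apply: ler_pM; rewrite ?powR_ge0//.
    apply: (le_trans (@powR_le_ends _ (1 - z) 1 _ _ _ _)); rewrite ?powR1//; lra.
  (* The length z of the interval supplies the missing power: c^n z <= z^(n + 1). *)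
  rewrite exprSr !normrM [leRHS]mulrA ler_wpM2r// ler_wpM2l ?mulr_ge0//.
  rewrite (ger0_norm (exprn_ge0 _ (ltW c0))) ger0_norm ?exprn_ge0//.
  by apply: lerXn2r; rewrite ?nnegrE ltW.
rewrite -(cvg_shiftS (fun n => G n z)); apply/subr_cvg0; apply/norm_cvg0P.
apply: (@squeeze_cvgr _ _ _ _ (fun=> 0)
  (fun n => M * `|n.+1%:R * binom_coef a n.+1 * z ^+ n.+1|)).
- by apply: nearW => n; rewrite normr_ge0 bound.
- exact: cvg_cst.
- rewrite -[X in _ --> X](mulr0 M); apply: cvgMl_tmp.
  rewrite (cvg_shiftS (fun n => `|n%:R * binom_coef a n * z ^+ n|)).
  by apply/norm_cvg0P; exact: cvg_binom_coef.
Qed.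

Lemma Beta_add_nat {R : realType} (a b : R) k : 0 < a -> 0 < b ->
  Beta (a + k%:R) b = rising a k / rising (a + b) k * Beta a b.
Proof.
move=> a0 b0; elim: k => [|k IH]; first by rewrite addr0 !rising0 divr1 mul1r.
have ak : 0 < a + k%:R by rewrite ltr_wpDr.
have abk : 0 < a + b + k%:R by rewrite ltr_wpDr// addr_gt0.
rewrite -natr1 addrA (Beta_recurrence ak b0) IH (risingS a k) (risingS (a + b) k).
have := rising_gt0 k (addr_gt0 a0 b0).
have -> : a + k%:R + b = a + b + k%:R by rewrite addrAC.
move: abk; move: (a + b + k%:R) (rising (a + b) k) (rising a k) (a + k%:R) (Beta a b).
move=> u v w y z u0 v0.
by field; rewrite !gt_eqF.
Qed.

(** Once [- c <= N], the coefficients from index N on share a sign, so the signed partial sums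
    increase towards a limit of size at most 1. The terms before N contribute at most the sum of
    their absolute coefficients. *)
Lemma binom_sum_bounded {R : realType} (c : R) : c <= 0 ->
  exists C : R, forall n z, 0 <= z < 1 -> `|binom_sum c n z| <= C.
Proof.
move=> c0.
have [N hN] : exists N : nat, - c <= N%:R.
  by exists (Num.truncn (- c)).+1; apply/ltW; exact: truncnS_gt.
(* [s] is the common sign of the coefficients from index N on. *)
pose s : R := if 0 <= binom_coef c N then 1 else -1.
have s1 : `|s| = 1 by rewrite /s; case: ifP; rewrite ?normrN normr1.
have sc j : 0 <= s * binom_coef c (N + j).
  elim: j => [|j IH].
    rewrite addn0 /s; case: ifPn => [|/negP/negP]; rewrite ?mul1r//.
    by rewrite -ltNge mulN1r oppr_ge0 => /ltW.
  rewrite addnS -(pmulr_rge0 _ (ltr0Sn R (N + j))) mulrCA binom_coefS mulrCA.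
  by rewrite mulr_ge0// natrD; have := ler0n R j; lra.
pose D := \sum_(0 <= k < N) `|binom_coef c k|.
exists (D + 1) => n z z01; have /andP[z0 z1] := z01.
have small m : (m <= N)%N -> `|binom_sum c m z| <= D.
  move=> mN; rewrite (le_trans (ler_norm_sum _ _ _))//.
  rewrite /D (big_cat_nat (leq0n m) mN)//= ler_wpDr ?sumr_ge0//.
  apply: ler_sum => k _; rewrite normrM ler_piMr// ger0_norm ?exprn_ge0//.
  by rewrite exprn_ile1// ltW.
have [nN|Nn] := leqP n N; first by rewrite (le_trans (small _ nN))// lerDl.
pose u j := s * binom_sum c (j + N) z.
have ndu : {homo u : i j / (i <= j)%N >-> i <= j}.
  apply/nondecreasing_seqP => j; rewrite /u addSn /binom_sum big_nat_recr//=.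
  by rewrite mulrDr lerDl mulrA mulr_ge0 ?exprn_ge0// addnC.
have cu : u j @[j --> \oo] --> s * (1 - z) `^ (- c).
  apply: cvgMl_tmp; rewrite (cvg_shiftn N (fun j => binom_sum c j z)).
  exact: cvg_binom_sum.
have un : u (n - N)%N = s * binom_sum c n z by rewrite /u subnK// ltnW.
have ub : u (n - N)%N <= s * (1 - z) `^ (- c).
  have <- := cvg_lim (@Rhausdorff R) cu.
  by apply: nondecreasing_cvgn_le => //; apply/cvg_ex; eexists; exact: cu.
have lb : u 0%N <= u (n - N)%N by exact: ndu.
have p1 : (1 - z) `^ (- c) <= 1.
  have : (1 - z) `^ (- c) <= 1 `^ (- c).
    by apply: ge0_ler_powR; rewrite ?nnegrE ?oppr_ge0//; lra.
  by rewrite powR1.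
have D0 : 0 <= D by rewrite sumr_ge0.
have : `|u 0%N| <= D by rewrite /u add0n normrM s1 mul1r small.
have -> : `|binom_sum c n z| = `|u (n - N)%N| by rewrite un normrM s1 mul1r.
rewrite !ler_norml => /andP[l1 _]; apply/andP; split; first lra.
rewrite (le_trans ub)//.
have : s * (1 - z) `^ (- c) <= `|s * (1 - z) `^ (- c)| by exact: ler_norm.
by rewrite normrM s1 mul1r (ger0_norm (powR_ge0 _ _)); lra.
Qed.

(** * Termwise integration against the beta kernel *)

Lemma measurable_binom_sum {R : realType} (c p : R) n (D : set R) :
  measurable_fun D (fun t : R => binom_sum c n (t * p)).
Proof.
apply: measurable_sum => k; apply: measurable_funM => //.
by apply: measurable_funX; exact: measurable_funM.
Qed.

(** For [c <= 0] the uniform bound on the partial sums dominates; for [c > 0] the terms are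
    nonnegative and monotone convergence applies. The limit lives in the extended reals: it can be
    infinite when [c > 0] and [p = 1]. *)
Lemma cvg_integral_binom_sum {R : realType} (a b c p : R) :
  0 < a -> 0 < b -> 0 <= p <= 1 ->
  (\int[mu]_(t in `]0%R, 1%R[) (beta_kernel a b t * binom_sum c n (t * p))%:E)%E
    @[n --> \oo] -->
  (\int[mu]_(t in `]0%R, 1%R[) (beta_kernel a b t * (1 - t * p) `^ (- c))%:E)%E.
Proof.
move=> a0 b0 /andP[p0 p1].
have tp (t : R) : (`]0, 1[%classic : set R) t -> 0 <= t * p < 1.
  rewrite /= in_itv/= => /andP[t0 t1]; rewrite mulr_ge0 ?(ltW t0)//=.
  by rewrite (le_lt_trans _ t1)// ler_piMr// (ltW t0).
have mS n : measurable_fun (`]0, 1[ : set R)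
    (fun t : R => (beta_kernel a b t * binom_sum c n (t * p))%:E).
  apply/measurable_EFinP; apply: measurable_funM.
    exact: measurable_beta_kernel.
  exact: measurable_binom_sum.
have cS (t : R) : (`]0, 1[%classic : set R) t ->
    (beta_kernel a b t * binom_sum c n (t * p))%:E @[n --> \oo] -->
    (beta_kernel a b t * (1 - t * p) `^ (- c))%:E.
  move=> t01; apply: cvg_EFin; first exact: nearW.
  by apply: cvgMl_tmp; apply: cvg_binom_sum; exact: tp.
have [c0|c0] := leP c 0.
  have [C hC] := binom_sum_bounded c0.
  apply: (@dominated_cvg _ _ _ mu _ (measurable_itv _) _ _
    (fun t : R => C%:E * (beta_kernel a b t)%:E)%E) => //.
  - by apply: integrableZl => //; exact: integrable_beta_kernel.
  - move=> n t t01; rewrite abse_EFin -EFinM lee_fin normrM mulrC.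
    rewrite (ger0_norm (beta_kernel_ge0 _ _ _)) ler_wpM2r ?beta_kernel_ge0//.
    by apply: hC; exact: tp.
rewrite (_ : (\int[mu]_(t in _) (beta_kernel a b t * (1 - t * p) `^ (- c))%:E)%E
  = (\int[mu]_(t in `]0%R, 1%R[) limn (fun n =>
      (beta_kernel a b t * binom_sum c n (t * p))%:E))%E); last first.
  apply: eq_integral => t; rewrite inE => t01.
  by apply/esym/cvg_lim => //; exact: cS.
apply: cvg_monotone_convergence => //.
- move=> n t t01; rewrite lee_fin mulr_ge0 ?beta_kernel_ge0// sumr_ge0// => k _.
  have /andP[h _] := tp _ t01.
  by rewrite mulr_ge0 ?exprn_ge0// divr_ge0// ltW// rising_gt0.
- move=> t t01; apply/nondecreasing_seqP => n; rewrite lee_fin.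
  rewrite ler_wpM2l ?beta_kernel_ge0// /binom_sum big_nat_recr//= lerDl.
  have /andP[h _] := tp _ t01.
  by rewrite mulr_ge0 ?exprn_ge0// divr_ge0// ltW// rising_gt0.
Qed.

(** The power t^k raises the first beta parameter to a + k, and the quotient of [Beta (a + k) b] by
    [Beta a b] supplies the two remaining rising factorials. *)
Lemma integral_beta_kernel_binom_sum {R : realType} (a b c p : R) n :
  0 < a -> 0 < b ->
  (\int[mu]_(t in `]0%R, 1%R[) (beta_kernel a b t * binom_sum c n (t * p))%:E)%E =
  (Beta a b * \sum_(0 <= k < n)
    (rising c k * rising a k / rising (a + b) k * p ^+ k / k`!%:R))%:E.
Proof.
move=> a0 b0.
have ak k : 0 < a + k%:R by rewrite ltr_wpDr.
transitivity (\int[mu]_(t in `]0%R, 1%R[) (\sum_(0 <= k < n)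
    ((binom_coef c k * p ^+ k)%:E * (beta_kernel (a + k%:R) b t)%:E)))%E.
  apply: eq_integral => t; rewrite inE/= in_itv/= => /andP[t0 _].
  rewrite sumEFin; congr EFin; rewrite /binom_sum mulr_sumr; apply: eq_bigr => k _.
  rewrite /beta_kernel (_ : a + k%:R - 1 = a - 1 + k%:R); last by rewrite addrAC.
  rewrite (@powRD _ t (a - 1) k%:R); last by apply/implyP => _; rewrite gt_eqF.
  by rewrite powR_mulrn ?ltW// exprMn; ring.
rewrite integral_sum//; last first.
  by move=> k; apply: integrableZl => //; exact: integrable_beta_kernel.
rewrite mulr_sumr -sumEFin; apply: eq_bigr => k _.
rewrite integralZl//; last exact: integrable_beta_kernel.
rewrite integral_beta_kernel// -EFinM Beta_add_nat// /binom_coef.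
by congr EFin; ring.
Qed.

(** Up to the positive factor [Beta a b], the partial sums of the Gauss series are the integrals of
    the truncated binomial series. Both sides may be [+oo]. *)
Theorem Euler_integral {R : realType} (a b c p : R) :
  0 < a -> 0 < b -> 0 <= p <= 1 ->
  ((Beta a b)%:E * hypergeo2F1 c a (a + b) p =
   \int[mu]_(t in `]0%R, 1%R[) (beta_kernel a b t * (1 - t * p) `^ (- c))%:E)%E.
Proof.
move=> a0 b0 p01; have B0 := Beta_gt0 a0 b0.
set I := (RHS).
suff -> : hypergeo2F1 c a (a + b) p = ((Beta a b)^-1%:E * I)%E.
  by rewrite muleA -EFinM mulfV ?mul1e// gt_eqF.
apply/cvg_lim => //.
rewrite (_ : (fun n => _) = (fun n => (Beta a b)^-1%:E *
   (\int[mu]_(t in `]0%R, 1%R[)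
      (beta_kernel a b t * binom_sum c n (t * p))%:E))%E).
  by apply: cvgeZl => //; exact: cvg_integral_binom_sum.
apply/funext => n; rewrite integral_beta_kernel_binom_sum// -EFinM mulrA.
by rewrite mulVf ?gt_eqF// mul1r sumEFin.
Qed.

(** * Derivatives of the normalizing integral in the exponents *)

(** With u = x^(-e) the claim becomes log u <= u, a consequence of 1 + v <= exp v at v = log u. *)
Lemma powR_ln_bound {R : realType} (x e : R) : 0 < x <= 1 -> 0 < e ->
  x `^ e * `|ln x| <= e^-1.
Proof.
move=> /andP[x0 x1] e0; rewrite ler0_norm ?ln_le0//.
rewrite -(ler_pM2l e0) mulfV ?gt_eqF// mulrCA.
have -> : e * - ln x = - ln (x `^ e) by rewrite ln_powR mulrN.
have xe0 : 0 < x `^ e by rewrite powR_gt0.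
rewrite -(ler_pM2l (_ : 0 < (x `^ e)^-1)) ?invr_gt0// mulrA mulVf ?gt_eqF// mul1r mulr1.
rewrite -lnV ?posrE// -{2}(@lnK _ (x `^ e)^-1) ?posrE ?invr_gt0//.
by rewrite (le_trans _ (expR_ge1Dx _))// lerDr.
Qed.

Lemma is_derive_powR_exponent {R : realType} (x s : R) : 0 < x ->
  is_derive s 1 (fun r : R => x `^ r) (x `^ s * ln x).
Proof.
move=> x0; rewrite (_ : (fun r => _) = expR \o (fun r => r * ln x)); last first.
  by apply/funext => r; rewrite /powR gt_eqF.
have h : is_derive s 1 (fun r : R => r * ln x) (ln x).
  by apply: is_derive_eq; rewrite /GRing.scale/=; ring.
have := @is_derive1_comp _ expR (fun r => r * ln x) s _ _ (is_derive_expR _) h.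
by rewrite /powR gt_eqF.
Qed.


(** * Differentiating the integral of w(t) b(t)^s in s *)

Section power_family.
Context {R : realType} (w b : R -> R) (s0 s : R).
Hypothesis mw : measurable_fun (`]0, 1[ : set R) w.
Hypothesis mb : measurable_fun (`]0, 1[ : set R) b.
Hypothesis w_ge0 : forall t, 0 < t < 1 -> 0 <= w t.
Hypothesis b01 : forall t, 0 < t < 1 -> 0 < b t <= 1.
Hypothesis s0s : s0 < s.
Hypothesis int_s0 : mu.-integrable `]0, 1[ (EFin \o (fun t => w t * b t `^ s0)).

Let measurable_family r :
  measurable_fun (`]0, 1[ : set R) (fun t => w t * b t `^ r).
Proof.
by apply: measurable_funM => //; exact: (measurableT_comp (measurable_powR r)).
Qed.

Let integrable_family r : s0 < r ->
  mu.-integrable `]0, 1[ (EFin \o (fun t => w t * b t `^ r)).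
Proof.
move=> s0r; apply: le_integrable int_s0 => //.
  by apply/measurable_EFinP; exact: measurable_family.
move=> t; rewrite /= in_itv/= => t01; rewrite lee_fin !ger0_norm; last 2 first.
- by rewrite mulr_ge0 ?w_ge0 ?powR_ge0.
- by rewrite mulr_ge0 ?w_ge0 ?powR_ge0.
by rewrite ler_wpM2l ?w_ge0// ger_powR ?b01 ?ltW.
Qed.

(** Since b <= 1, the exponent x can be lowered to u. Splitting b^u as b^(u - s0) b^s0 lets the
    first factor absorb the logarithm, uniformly in x >= u. *)
Let family_ln_bound u x t : s0 < u -> u <= x -> 0 < t < 1 ->
  `|w t * (b t `^ x * ln (b t))| <= (u - s0)^-1 * `|w t * b t `^ s0|.
Proof.
move=> s0u ux t01; have /andP[bt0 bt1] := b01 t01.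
rewrite !normrM [leRHS]mulrCA ler_wpM2l// (ger0_norm (powR_ge0 _ _)).
rewrite (ger0_norm (powR_ge0 _ _)).
apply: (@le_trans _ _ (b t `^ u * `|ln (b t)|)).
  by rewrite ler_wpM2r// ger_powR// bt0.
rewrite -{1}(subrK s0 u) powRD; last by apply/implyP => _; rewrite gt_eqF.
rewrite mulrAC ler_wpM2r ?powR_ge0//.
by apply: powR_ln_bound; rewrite ?subr_gt0// bt0.
Qed.

Lemma integrable_power_family_ln : mu.-integrable `]0, 1[
  (EFin \o (fun t => w t * (b t `^ s * ln (b t)))).
Proof.
pose c : R := (s - s0)^-1.
have : mu.-integrable `]0, 1[ (fun t => c%:E * (w t * b t `^ s0)%:E)%E.
  exact: integrableZl.
apply: le_integrable => //.
  apply/measurable_EFinP; apply: measurable_funM => //.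
  apply: measurable_funM.
    exact: (measurableT_comp (measurable_powR s)).
  exact: (measurableT_comp (@measurable_ln R)).
move=> t; rewrite /= in_itv/= => t01.
rewrite lee_fin [leRHS]normrM.
rewrite (ger0_norm (_ : 0 <= c)) ?invr_ge0 ?subr_ge0 ?(ltW s0s)//.
exact: family_ln_bound.
Qed.

Lemma is_derive_power_family : is_derive s 1
  (fun r => \int[mu]_(t in `]0%R, 1%R[) (w t * b t `^ r))
  (\int[mu]_(t in `]0%R, 1%R[) (w t * (b t `^ s * ln (b t)))).
Proof.
pose f (r t : R) := w t * b t `^ r.
(* The neighbourhood []u, s + 1[] of s keeps a positive distance from s0, so one dominating function
   serves all its exponents. *)
pose u := (s0 + s) / 2.
have s0u : s0 < u by rewrite (midf_lt s0s).
have us : u < s by rewrite (midf_lt s0s).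
have dfE (x t : R) : 0 < t < 1 ->
    is_derive x 1 (f ^~ t) (w t * (b t `^ x * ln (b t))).
  move=> t01; have /andP[bt0 _] := b01 t01.
  have h := is_derive_powR_exponent x bt0.
  exact: (is_deriveZ (w t) h).
have d1E (x t : R) : 0 < t < 1 -> partial1of2 f x t = w t * (b t `^ x * ln (b t)).
  by move=> t01; rewrite partial1of2E; have h := dfE x t t01; rewrite derive_val.
pose G (t : R) : R := (u - s0)^-1 * `|w t * b t `^ s0|.
have G0 t : 0 <= G t by rewrite mulr_ge0// invr_ge0 subr_ge0 ltW.
have intG : mu.-integrable `]0, 1[ (EFin \o G).
  have := integrable_abse int_s0 => h.
  have := @integrableZl _ _ _ mu _ (measurable_itv _) (u - s0)^-1 _ h.
  exact.
have Is : (`]u, (s + 1)[%classic : set R) s by rewrite /= in_itv/= us ltrDl ltr01.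
have intf x : (`]u, (s + 1)[%classic : set R) x ->
    mu.-integrable `]0, 1[ (EFin \o f x).
  rewrite /= in_itv/= => /andP[ux _]; apply: integrable_family.
  exact: lt_trans ux.
have derf (x t : R) : (`]u, (s + 1)[%classic : set R) x ->
    (`]0, 1[%classic : set R) t -> derivable (f ^~ t) x 1.
  by move=> _; rewrite /= in_itv/= => t01; have [] := dfE x t t01.
have Gub (x t : R) : (`]u, (s + 1)[%classic : set R) x ->
    (`]0, 1[%classic : set R) t -> `|partial1of2 f x t| <= G t.
  rewrite /= !in_itv/= => /andP[ux _] t01; rewrite d1E//.
  by apply: family_ln_bound => //; exact: ltW.
have mI : measurable (`]0%R, 1%R[%classic : set R) by exact: measurable_itv.
apply: DeriveDef.
  exact (@derivable_under_integral R _ _ mu f _ mI s u (s + 1) Is intf derf G G0 intG Gub).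
rewrite -derive1E; apply: (etrans (@differentiation_under_integral R _ _ mu f
  _ mI s u (s + 1) Is intf derf G G0 intG Gub)).
by apply: eq_Rintegral => t; rewrite inE/= in_itv/= => /d1E ->.
Qed.

End power_family.

(** * The normalizing integral *)

Lemma onem_mul_itv {R : realType} (t p : R) : 0 < t < 1 -> 0 <= p <= 1 ->
  [/\ 0 < 1 - t * p, 1 - t * p <= 1 & 1 - t <= 1 - t * p].
Proof.
move=> /andP[t0 t1] /andP[p0 p1].
have h1 : 0 <= t * p by rewrite mulr_ge0// ltW.
have h2 : t * p <= t by rewrite ler_piMr// ltW.
by split; lra.
Qed.

(** On the open interval all three bases are positive, including 1 - t p at p = 1. *)
Definition lpush_Z {R : realType} (a b g p : R) : R :=
  \int[mu]_(t in `]0%R, 1%R[) lpush_kernel a b g p t.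

Lemma lpush_kernelE {R : realType} (a b g p t : R) :
  lpush_kernel a b g p t = beta_kernel a b t * (1 - t * p) `^ g.
Proof. by []. Qed.

Lemma measurable_lpush_kernel {R : realType} (a b g p : R) (D : set R) :
  measurable_fun D (lpush_kernel a b g p).
Proof.
apply: measurable_funM; first exact: measurable_beta_kernel.
exact: measurable_powR_affine.
Qed.

Lemma lpush_ZE {R : realType} (a b g p : R) :
  \int[mu]_(t in `[0%R, 1%R]) lpush_kernel a b g p t = lpush_Z a b g p.
Proof.
rewrite /lpush_Z /Rintegral integral_itv_bndoo//.
by apply/measurable_EFinP; exact: measurable_lpush_kernel.
Qed.

Lemma lpush_kernel_gt0 {R : realType} (a b g p t : R) :
  0 < t < 1 -> 0 <= p <= 1 -> 0 < lpush_kernel a b g p t.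
Proof.
move=> t01 p01; have [h _ _] := onem_mul_itv t01 p01.
by rewrite mulr_gt0 ?powR_gt0// beta_kernel_gt0.
Qed.

Lemma lpush_kernel_ge0 {R : realType} (a b g p t : R) :
  0 <= lpush_kernel a b g p t.
Proof. by rewrite !mulr_ge0 ?powR_ge0. Qed.

Lemma lpush_kernel_le {R : realType} (a b g p t : R) : 0 <= g ->
  0 < t < 1 -> 0 <= p <= 1 -> lpush_kernel a b g p t <= beta_kernel a b t.
Proof.
move=> g0 t01 p01; have [h1 h2 _] := onem_mul_itv t01 p01.
rewrite lpush_kernelE ler_piMr ?beta_kernel_ge0//.
have : (1 - t * p) `^ g <= 1 `^ g.
  by apply: ge0_ler_powR; rewrite // nnegrE ltW.
by rewrite powR1.
Qed.

Lemma integrable_lpush_kernel {R : realType} (a b g p : R) :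
  0 < a -> 0 < b -> 0 <= g -> 0 <= p <= 1 ->
  mu.-integrable `]0, 1[ (EFin \o lpush_kernel a b g p).
Proof.
move=> a0 b0 g0 p01; apply: le_integrable (integrable_beta_kernel a0 b0) => //.
  by apply/measurable_EFinP; exact: measurable_lpush_kernel.
move=> t; rewrite /= in_itv/= => t01; rewrite lee_fin.
rewrite (ger0_norm (lpush_kernel_ge0 _ _ _ _ _)).
by rewrite (ger0_norm (beta_kernel_ge0 _ _ _)) lpush_kernel_le.
Qed.

Lemma lpush_Z_gt0 {R : realType} (a b g p : R) :
  0 < a -> 0 < b -> 0 <= g -> 0 <= p <= 1 -> 0 < lpush_Z a b g p.
Proof.
move=> a0 b0 g0 p01; apply: Rintegral_gt0; first exact: integrable_lpush_kernel.
by move=> t t01; exact: lpush_kernel_gt0.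
Qed.

Lemma measurable_affine {R : realType} (p : R) (D : set R) :
  measurable_fun D (fun t : R => 1 - t * p).
Proof.
by apply: measurable_funTS; apply: measurable_funB => //; exact: measurable_funM.
Qed.

(** [K] has to agree with w b^r on the open interval only, so the same statement serves
    [lpush_kernel] in each of its three exponents. *)
Lemma power_family_lpush {R : realType} (w b : R -> R) (s0 s : R)
    (K : R -> R -> R) :
  measurable_fun (`]0, 1[ : set R) w -> measurable_fun (`]0, 1[ : set R) b ->
  (forall t, 0 < t < 1 -> 0 <= w t) ->
  (forall t, 0 < t < 1 -> 0 < b t <= 1) ->
  s0 < s ->
  (forall r t, 0 < t < 1 -> K r t = w t * b t `^ r) ->
  mu.-integrable `]0, 1[ (EFin \o K s0) ->
  mu.-integrable `]0, 1[ (EFin \o (fun t => ln (b t) * K s t)) /\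
  is_derive s 1 (fun r => \int[mu]_(t in `]0%R, 1%R[) K r t)
    (\int[mu]_(t in `]0%R, 1%R[) (ln (b t) * K s t)).
Proof.
move=> mw mb w0 b01 s0s KE int_s0.
have int_s0' : mu.-integrable `]0, 1[ (EFin \o (fun t => w t * b t `^ s0)).
  apply: eq_integrable int_s0 => // t; rewrite inE/= in_itv/= => t01.
  by rewrite KE.
split.
  have := integrable_power_family_ln mw mb b01 s0s int_s0'.
  apply: eq_integrable => // t; rewrite inE/= in_itv/= => t01.
  by congr EFin; rewrite KE//; ring.
have := is_derive_power_family mw mb w0 b01 s0s int_s0'.
rewrite (_ : (fun r => \int[mu]_(t in `]0%R, 1%R[) K r t) =
    (fun r => \int[mu]_(t in `]0%R, 1%R[) (w t * b t `^ r))); last first.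
  apply/funext => r; apply: eq_Rintegral => t.
  by rewrite inE/= in_itv/= => t01; rewrite KE.
rewrite (_ : \int[mu]_(t in `]0%R, 1%R[) (ln (b t) * K s t) =
    \int[mu]_(t in `]0%R, 1%R[) (w t * (b t `^ s * ln (b t))))//.
apply: eq_Rintegral => t.
by rewrite inE/= in_itv/= => t01; rewrite KE//; ring.
Qed.

(** The base is t; the shift by -1 in its exponent goes into the weight. The exponent a / 2 is
    smaller than a and still gives an integrable kernel. *)
Lemma is_derive_lpush_Z_alpha {R : realType} (a b g p : R) :
  0 < a -> 0 < b -> 0 <= g -> 0 <= p <= 1 ->
  mu.-integrable `]0, 1[ (EFin \o (fun t => ln t * lpush_kernel a b g p t)) /\
  is_derive a 1 (fun r => lpush_Z r b g p)
    (\int[mu]_(t in `]0%R, 1%R[) (ln t * lpush_kernel a b g p t)).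
Proof.
move=> a0 b0 g0 p01.
apply: (@power_family_lpush _
  (fun t => t `^ (- 1) * (1 - t) `^ (b - 1) * (1 - t * p) `^ g) id (a / 2) a
  (fun r t => lpush_kernel r b g p t)).
- apply: measurable_funM; last exact: measurable_powR_affine.
  have := @measurable_beta_kernel R 0 b (`]0, 1[ : set R).
  by rewrite /beta_kernel sub0r.
- exact: measurable_id.
- by move=> t _; rewrite !mulr_ge0 ?powR_ge0.
- by move=> t /andP[t0 t1]; rewrite t0 ltW.
- by rewrite ltr_pdivrMr// ltr_pMr// ltr1n.
- move=> r t /andP[t0 _]; rewrite /lpush_kernel powRD; last first.
    by apply/implyP => _; rewrite gt_eqF.
  by ring.
- by apply: integrable_lpush_kernel => //; rewrite divr_gt0.
Qed.

Lemma is_derive_lpush_Z_beta {R : realType} (a b g p : R) :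
  0 < a -> 0 < b -> 0 <= g -> 0 <= p <= 1 ->
  mu.-integrable `]0, 1[
    (EFin \o (fun t => ln (1 - t) * lpush_kernel a b g p t)) /\
  is_derive b 1 (fun r => lpush_Z a r g p)
    (\int[mu]_(t in `]0%R, 1%R[) (ln (1 - t) * lpush_kernel a b g p t)).
Proof.
move=> a0 b0 g0 p01.
apply: (@power_family_lpush _
  (fun t => t `^ (a - 1) * (1 - t) `^ (- 1) * (1 - t * p) `^ g)
  (fun t => 1 - t) (b / 2) b (fun r t => lpush_kernel a r g p t)).
- apply: measurable_funM; last exact: measurable_powR_affine.
  have := @measurable_beta_kernel R a 0 (`]0, 1[ : set R).
  by rewrite /beta_kernel sub0r.
- exact: measurable_funB.
- by move=> t _; rewrite !mulr_ge0 ?powR_ge0.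
- by move=> t /andP[t0 t1]; lra.
- by rewrite ltr_pdivrMr// ltr_pMr// ltr1n.
- move=> r t /andP[_ t1]; rewrite /lpush_kernel (@powRD _ (1 - t)); last first.
    by apply/implyP => _; rewrite subr_eq0 gt_eqF.
  by ring.
- by apply: integrable_lpush_kernel => //; rewrite divr_gt0.
Qed.

(* The exponent -b/2 < g leaves room for differentiating at g = 0 from both
   sides, even when p = 1. *)
Lemma is_derive_lpush_Z_gamma {R : realType} (a b g p : R) :
  0 < a -> 0 < b -> 0 <= g -> 0 <= p <= 1 ->
  mu.-integrable `]0, 1[
    (EFin \o (fun t => ln (1 - t * p) * lpush_kernel a b g p t)) /\
  is_derive g 1 (fun r => lpush_Z a b r p)
    (\int[mu]_(t in `]0%R, 1%R[) (ln (1 - t * p) * lpush_kernel a b g p t)).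
Proof.
move=> a0 b0 g0 p01.
apply: (@power_family_lpush _ (beta_kernel a b)
  (fun t => 1 - t * p) (- (b / 2)) g (fun r t => lpush_kernel a b r p t)).
- exact: measurable_beta_kernel.
- exact: measurable_affine.
- by move=> t _; exact: beta_kernel_ge0.
- by move=> t t01; have [-> -> _] := onem_mul_itv t01 p01.
- by rewrite (lt_le_trans _ g0)// oppr_lt0 divr_gt0.
- by [].
(* As 1 - t <= 1 - t p, the factor (1 - t p)^(- b / 2) is at most (1 - t)^(- b / 2), which leaves a
   beta kernel with second parameter b / 2. *)
- have b20 : 0 < b / 2 by rewrite divr_gt0.
  apply: le_integrable (integrable_beta_kernel a0 b20) => //.
    by apply/measurable_EFinP; exact: measurable_lpush_kernel.
  move=> t; rewrite /= in_itv/= => t01; rewrite lee_fin.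
  rewrite (ger0_norm (lpush_kernel_ge0 _ _ _ _ _)).
  rewrite (ger0_norm (beta_kernel_ge0 _ _ _)).
  have [h1 _ h2] := onem_mul_itv t01 p01; have /andP[t0 t1] := t01.
  rewrite /lpush_kernel /beta_kernel -mulrA ler_wpM2l ?powR_ge0//.
  have -> : b / 2 - 1 = (b - 1) - b / 2 by field.
  rewrite (@powRD _ (1 - t) (b - 1)); last first.
    by apply/implyP => _; rewrite subr_eq0 gt_eqF.
  rewrite ler_wpM2l ?powR_ge0// !powRN lef_pV2 ?posrE ?powR_gt0 ?subr_gt0//.
    by apply: ge0_ler_powR => //; rewrite ?nnegrE; lra.
  by rewrite -subr_gt0.
Qed.

(** * One-sided derivatives and the derivative in phi *)

(** Reduces the limit to sequences, for which dominated convergence and Fatou's lemma are stated.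
    The radius [e] confines the sequences to a neighbourhood where bounds are uniform. If the limit
    failed, points within 1 / (n + 1) of x would form a counterexample. *)
Lemma cvg_within_dnbhs_seq {R : realType} (D : set R) (f : R -> \bar R)
    (x e : R) (l : \bar R) : 0 < e ->
  (forall u : nat -> R, (forall n, [/\ D (u n), u n != x & `|u n - x| < e]) ->
     u n @[n --> \oo] --> x -> f (u n) @[n --> \oo] --> l) ->
  f y @[y --> within D x^'] --> l.
Proof.
move=> e0 H; apply: contrapT => ncvg.
have [A [lA nA]] : exists A, nbhs l A /\ ~ (within D x^') (f @^-1` A).
  apply: contrapT => h; apply: ncvg => A lA /=.
  by apply: contrapT => nA; apply: h; exists A.
have exu n : exists y : R, [/\ D y, y != x, `|y - x| < Num.min e (harmonic n)
    & ~ A (f y)].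
  apply: contrapT => h; apply: nA.
  have m0 : 0 < Num.min e (harmonic n) by rewrite lt_min e0 harmonic_gt0.
  exists (Num.min e (harmonic n)) => //= y xy yx Dy.
  apply: contrapT => nAy; apply: h; exists y; split=> //.
  by rewrite distrC.
have [u hu] := choice exu.
have uD n : [/\ D (u n), u n != x & `|u n - x| < e].
  have [h1 h2 h3 _] := hu n; split=> //.
  by rewrite (lt_le_trans h3)// ge_min lexx.
have cu : u n @[n --> \oo] --> x.
  apply/subr_cvg0/norm_cvg0P.
  apply: (@squeeze_cvgr _ _ _ _ (fun=> 0) harmonic).
  - apply: nearW => n; rewrite normr_ge0/= ltW//.
    by have [_ _ h _] := hu n; rewrite (lt_le_trans h)// ge_min lexx orbT.
  - exact: cvg_cst.
  - exact: cvg_harmonic.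
have := H u uD cu A lA.
by move=> [N _ /(_ N (leqnn N))] /=; have [_ _ _] := hu N.
Qed.

Lemma is_derive_has_derivative_in {R : realType} (D : set R) (f : R -> R)
    (x l : R) :
  is_derive x 1 f l -> has_derivative_in D f x l%:E.
Proof.
move=> [df dl]; rewrite /has_derivative_in.
apply: (@cvg_within_dnbhs_seq _ _ _ _ 1) => // u uD cu.
apply: cvg_EFin; first exact: nearW.
have : h^-1 *: (f (h + x) - f x) @[h --> 0^'] --> l.
  rewrite -dl; move: df; rewrite /derivable => /cvg_ex[/= k hk].
  have -> : 'D_1 f x = k by apply/cvg_lim.
  by move: hk; under eq_fun do rewrite scaler1.
move=> /cvgr_dnbhsP/(_ (fun n => u n - x)) /=.
have -> : fine \o (fun n => ((f (u n) - f x) / (u n - x))%:E) =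
    (fun n => (u n - x)^-1 *: (f (u n - x + x) - f x)).
  by apply/funext => n; rewrite /= subrK mulrC.
apply; split=> [n|]; first by have [_ + _] := uD n; rewrite subr_eq0.
exact/subr_cvg0.
Qed.

Lemma has_derivative_in_eq {R : realType} (D : set R) (f g : R -> R) (x : R)
    (l : \bar R) : D x -> (forall y, D y -> f y = g y) ->
  has_derivative_in D f x l -> has_derivative_in D g x l.
Proof.
move=> Dx fg; apply: cvg_trans; apply: near_eq_cvg.
rewrite near_withinE; apply: nearW => y Dy /=.
by rewrite !fg.
Qed.

(** One of the two derivatives is finite, so the sum never has the form [+oo - oo]. *)
Lemma has_derivative_inD {R : realType} (D : set R) (f g : R -> R) (x l : R)
    (k : \bar R) :
  has_derivative_in D f x l%:E -> has_derivative_in D g x k ->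
  has_derivative_in D (fun y => f y + g y) x (l%:E + k)%E.
Proof.
move=> df dg; rewrite /has_derivative_in.
rewrite (_ : (fun y => _) = (fun y => ((f y - f x) / (y - x))%:E +
  ((g y - g x) / (y - x))%:E)%E); last first.
  by apply/funext => y; rewrite -EFinD; congr EFin; ring.
by apply: cvgeD => //; exact: fin_num_adde_defr.
Qed.

Lemma has_derivative_inZ {R : realType} (D : set R) (f : R -> R) (x c : R)
    (k : \bar R) :
  has_derivative_in D f x k ->
  has_derivative_in D (fun y => c * f y) x (c%:E * k)%E.
Proof.
move=> df; rewrite /has_derivative_in.
rewrite (_ : (fun y => _) = (fun y => c%:E * ((f y - f x) / (y - x))%:E)%E).
  by apply: cvgeZl.
by apply/funext => y; rewrite -EFinM; congr EFin; ring.
Qed.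

(** * Slopes of the normalizing integral in phi *)

Lemma MVT_between {R : realType} (f df : R -> R) (lo hi x y : R) :
  lo <= x <= hi -> lo <= y <= hi ->
  (forall z, lo <= z <= hi -> is_derive z 1 f (df z)) ->
  exists2 c, lo <= c <= hi & f y - f x = df c * (y - x).
Proof.
wlog xy : x y / x <= y.
  move=> W hx hy dff; have [xy|/ltW yx] := leP x y; first exact: W.
  have [c hc e] := W _ _ yx hy hx dff.
  by exists c => //; rewrite -(opprB (f x)) e -(opprB x) mulrN.
move=> /andP[lx xh] /andP[ly yh] dff.
have dfxy (z : R) : x <= z <= y -> is_derive z 1 f (df z).
  by move=> /andP[xz zy]; apply: dff; rewrite (le_trans lx)//= (le_trans zy).
have [||c] := @MVT_segment _ f df x y xy.
- by move=> z; rewrite in_itv/= => /andP[xz zy]; apply: dfxy; rewrite !ltW.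
- apply: derivable_within_continuous => z; rewrite in_itv/= => /dfxy.
  by case.
- rewrite in_itv/= => /andP[xc cy] e; exists c => //.
  by rewrite (le_trans lx)//= (le_trans cy).
Qed.

(** Fatou's lemma bounds the lower limit from below and [f_ n <= f] bounds every term from above;
    the common limit may be infinite. *)
Lemma ge0_le_cvg_integral {R : realType} (D : set R) (f_ : nat -> R -> \bar R)
    (f : R -> \bar R) : measurable D ->
  (forall n, measurable_fun D (f_ n)) -> measurable_fun D f ->
  (forall n x, D x -> (0 <= f_ n x)%E) -> (forall n x, D x -> (f_ n x <= f x)%E) ->
  (forall x, D x -> f_ n x @[n --> \oo] --> f x) ->
  (\int[mu]_(x in D) f_ n x)%E @[n --> \oo] --> (\int[mu]_(x in D) f x)%E.
Proof.
move=> mD mf_ mf f0 ff cf.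
have le n : (\int[mu]_(x in D) f_ n x <= \int[mu]_(x in D) f x)%E.
  by apply: ge0_le_integral => //; [exact: f0|exact: mf_|exact: ff].
have fat : (\int[mu]_(x in D) f x <=
    limn_einf (fun n => \int[mu]_(x in D) f_ n x))%E.
  rewrite (_ : (\int[mu]_(x in D) f x)%E =
      (\int[mu]_(x in D) limn_einf (f_^~ x))%E); last first.
    apply: eq_integral => x; rewrite inE => Dx.
    by rewrite (cvg_limn_einf_sup (cf x Dx)).1.
  exact: fatou.
(* After negation the bound on the lower limit becomes one on the upper limit. *)
apply/cvgeNP; apply: limn_esup_le_cvg => [|n]; last by rewrite leeN2.
by rewrite (limn_esupN (fun n => \int[mu]_(x in D) f_ n x)%E) leeN2.
Qed.

(** Mean value theorem in the parameter. Keeping c below [hi] rather than 1 holds 1 - t c away from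
    0 when [hi < 1]. *)
Lemma powR_slope {R : realType} (g phi hi u t : R) :
  0 < t < 1 -> hi <= 1 -> 0 <= phi <= hi -> 0 <= u <= hi -> u != phi ->
  exists2 c, 0 <= c <= hi &
    - (((1 - t * u) `^ g - (1 - t * phi) `^ g) / (u - phi)) =
    g * t * (1 - t * c) `^ (g - 1).
Proof.
move=> t01 hi1 phi01 u01 uphi.
have dd (z : R) : 0 <= z <= hi -> is_derive z 1 (fun p => (1 - t * p) `^ g)
    (- (g * t * (1 - t * z) `^ (g - 1))).
  move=> /andP[z0 zhi].
  have z01 : 0 <= z <= 1 by rewrite z0 (le_trans zhi).
  have [h _ _] := onem_mul_itv t01 z01.
  rewrite (_ : (fun p => _) = (fun p => (1 - p * t) `^ g)); last first.
    by apply/funext => p; rewrite mulrC.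
  by rewrite [t * z]mulrC; apply: is_derive_powR_affine; rewrite mulrC.
have [c cI e] := MVT_between phi01 u01 dd.
by exists c => //; rewrite e mulfK ?opprK// subr_eq0.
Qed.

(** The opposite of the slope is taken because Z decreases in phi, so that all integrands are
    nonnegative. The limit is extended-real, as the integral can diverge at phi = 1. *)
Lemma cvg_lpush_Z_slope {R : realType} (a b g phi hi : R) (u : nat -> R) :
  0 < a -> 0 < b -> 0 <= g -> hi <= 1 -> 0 <= phi <= hi ->
  (hi < 1 \/ phi = 1) ->
  (forall n, 0 <= u n <= hi) -> (forall n, u n != phi) ->
  u n @[n --> \oo] --> phi ->
  (- ((lpush_Z a b g (u n) - lpush_Z a b g phi) / (u n - phi)))%:E
    @[n --> \oo] -->
  (g%:E * \int[mu]_(t in `]0%R, 1%R[)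
    (beta_kernel (a + 1) b t * (1 - t * phi) `^ (g - 1))%:E)%E.
Proof.
move=> a0 b0 g0 hi1 phi_hi hiphi u_hi u_neq cu.
have phi01 : 0 <= phi <= 1 by case/andP: phi_hi => -> h; rewrite (le_trans h).
have u01 n : 0 <= u n <= 1 by case/andP: (u_hi n) => -> h; rewrite (le_trans h).
pose v := beta_kernel a b.
pose q n (t : R) := - (((1 - t * u n) `^ g - (1 - t * phi) `^ g) / (u n - phi)).
pose q0 (t : R) := g * t * (1 - t * phi) `^ (g - 1).
have mq n (D : set R) : measurable_fun D (fun t => (v t * q n t)%:E).
  apply/measurable_EFinP; apply: measurable_funM; first exact: measurable_beta_kernel.
  apply: measurableT_comp => //; apply: measurable_funM => //.
  by apply: measurable_funB; exact: measurable_powR_affine.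
have mq0 (D : set R) : measurable_fun D (fun t => (v t * q0 t)%:E).
  apply/measurable_EFinP; apply: measurable_funM; first exact: measurable_beta_kernel.
  apply: measurable_funM; last exact: measurable_powR_affine.
  by apply: measurable_funM => //; exact: measurable_funTS.
have qE n (t : R) : 0 < t < 1 -> exists2 c, 0 <= c <= hi &
    q n t = g * t * (1 - t * c) `^ (g - 1).
  by move=> t01; exact: powR_slope.
have q_ge0 n (t : R) : 0 < t < 1 -> 0 <= q n t.
  move=> t01; have [c _ ->] := qE n t t01; have /andP[t0 _] := t01.
  by rewrite !mulr_ge0 ?powR_ge0// ltW.
have cq (t : R) : 0 < t < 1 -> q n t @[n --> \oo] --> q0 t.
  move=> t01; have [h _ _] := onem_mul_itv t01 phi01.
  have : is_derive phi 1 (fun p : R => (1 - p * t) `^ g)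
      (- (g * t * (1 - phi * t) `^ (g - 1))).
    by apply: is_derive_powR_affine; rewrite mulrC.
  move=> /(@is_derive_has_derivative_in _ setT) dd.
  have cuw : u n @[n --> \oo] --> within setT phi^'.
    move=> A; rewrite /= => -[e /= e0 eA].
    have /cvgrPdist_lt/(_ _ e0) := cu; apply: filterS => n /= h1.
    by apply: eA => //.
  have := cvg_comp _ _ cuw dd.
  move=> /fine_cvgP[_]; rewrite /comp /=.
  move=> /cvgN; rewrite opprK [phi * t]mulrC.
  rewrite /q /q0; apply: cvg_trans; apply: near_eq_cvg; apply: nearW => n.
  by rewrite [t * u n]mulrC.
have ZE n : (\int[mu]_(t in `]0%R, 1%R[) (v t * q n t)%:E)%E =
    (- ((lpush_Z a b g (u n) - lpush_Z a b g phi) / (u n - phi)))%:E.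
  have i1 := integrable_lpush_kernel a0 b0 g0 (u01 n).
  have i2 := integrable_lpush_kernel a0 b0 g0 phi01.
  rewrite /lpush_Z -RintegralB// mulrC -mulNr -RintegralZl//; last first.
    under [X in _.-integrable _ X]eq_fun do rewrite /= EFinB.
    exact: integrableB.
  rewrite /Rintegral fineK; last first.
    apply: integrable_fin_num => //.
    under [X in _.-integrable _ X]eq_fun do rewrite /= EFinM EFinB.
    by apply: integrableZl => //; exact: integrableB.
  apply: eq_integral => t _; congr EFin; rewrite !lpush_kernelE /q -/v.
  by ring.
have -> : (fun n => (- ((lpush_Z a b g (u n) - lpush_Z a b g phi) /
    (u n - phi)))%:E) = (fun n => \int[mu]_(t in `]0%R, 1%R[) (v t * q n t)%:E)%E.
  by apply/funext => n; rewrite ZE.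
have -> : (g%:E * \int[mu]_(t in `]0%R, 1%R[)
    (beta_kernel (a + 1) b t * (1 - t * phi) `^ (g - 1))%:E)%E =
    (\int[mu]_(t in `]0%R, 1%R[) (v t * q0 t)%:E)%E.
  (* For g = 0 both sides vanish even if the integral is infinite, by the convention 0 * oo = 0. *)
  rewrite -ge0_integralZl//; last 2 first.
  - apply/measurable_EFinP; apply: measurable_funM.
      exact: measurable_beta_kernel.
    exact: measurable_powR_affine.
  - by move=> t _; rewrite lee_fin mulr_ge0 ?beta_kernel_ge0 ?powR_ge0.
  apply: eq_integral => t; rewrite inE/= in_itv/= => /andP[t0 _].
  rewrite -EFinM; congr EFin; rewrite /v /q0 /beta_kernel addrK.
  by rewrite -[t `^ a](mulr_powR_pred a t0); ring.
have oo01 (t : R) : (`]0, 1[%classic : set R) t -> 0 < t < 1.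
  by rewrite /= in_itv.
have cvq (t : R) : (`]0, 1[%classic : set R) t ->
    (v t * q n t)%:E @[n --> \oo] --> (v t * q0 t)%:E.
  move=> /oo01 t01; apply: cvg_EFin; first exact: nearW.
  by apply: cvgMl_tmp; exact: cq.
have dominated (C : R) : (forall c t, 0 <= c <= hi -> 0 < t < 1 ->
    (1 - t * c) `^ (g - 1) <= C) ->
    (\int[mu]_(t in `]0%R, 1%R[) (v t * q n t)%:E)%E @[n --> \oo] -->
    (\int[mu]_(t in `]0%R, 1%R[) (v t * q0 t)%:E)%E.
  move=> hC; apply: (@dominated_cvg _ _ _ mu _ (measurable_itv _) _ _
    (fun t : R => (g * C)%:E * (v t)%:E)%E) => //.
  - by move=> n; exact: mq.
  - by apply: integrableZl => //; exact: integrable_beta_kernel.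
  - move=> n t /oo01 t01; rewrite abse_EFin -EFinM lee_fin normrM mulrC.
    rewrite (ger0_norm (beta_kernel_ge0 _ _ _)) ler_wpM2r ?beta_kernel_ge0//.
    rewrite ger0_norm ?q_ge0//; have [c chi ->] := qE n t t01.
    have /andP[t0 t1] := t01.
    apply: ler_pM; rewrite ?powR_ge0 ?mulr_ge0 ?(ltW t0)//; last exact: hC.
    by rewrite ler_piMr// ltW.
(* For g >= 1 the exponent g - 1 is nonnegative and the base at most 1. *)
have [g1|g1] := leP 1 g.
  apply: (dominated 1) => c t /andP[c0 chi] t01.
  have c01 : 0 <= c <= 1 by rewrite c0 (le_trans chi).
  have [h1 h2 _] := onem_mul_itv t01 c01.
  have : (1 - t * c) `^ (g - 1) <= 1 `^ (g - 1).
    by apply: ge0_ler_powR; rewrite ?nnegrE ?subr_ge0//; lra.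
  by rewrite powR1.
(* Now g - 1 < 0. If hi < 1 the base stays in [1 - hi, 1]. *)
case: hiphi => [hi_lt1|phi1].
  apply: (dominated ((1 - hi) `^ (g - 1) + 1)) => c t /andP[c0 chi] t01.
  have -> : (1 - hi) `^ (g - 1) + 1 = (1 - hi) `^ (g - 1) + 1 `^ (g - 1) :> R.
    by rewrite powR1.
  have c01 : 0 <= c <= 1 by rewrite c0 (le_trans chi).
  have [h1 h2 _] := onem_mul_itv t01 c01.
  apply: powR_le_ends; first by rewrite subr_gt0.
  rewrite h2 andbT lerD2l lerN2; have /andP[t0 t1] := t01.
  by rewrite (le_trans _ chi)// ler_piMl// ltW.
(* At phi = 1 no constant bound is at hand, but 1 - t <= 1 - t c and the negative exponent put every
   slope below the limit function. *)
apply: ge0_le_cvg_integral => //.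
- by move=> n t /oo01 t01; rewrite lee_fin mulr_ge0 ?beta_kernel_ge0 ?q_ge0.
- move=> n t /oo01 t01; rewrite lee_fin ler_wpM2l ?beta_kernel_ge0//.
  have [c /andP[c0 chi] ->] := qE n t t01; have /andP[t0 t1] := t01.
  rewrite /q0 phi1 mulr1 ler_wpM2l ?mulr_ge0 ?(ltW t0)//.
  have c01 : 0 <= c <= 1 by rewrite c0 (le_trans chi).
  have [h1 h2 h3] := onem_mul_itv t01 c01.
  rewrite -(opprB 1 g) !powRN lef_pV2 ?posrE ?powR_gt0 ?subr_gt0//.
    by apply: ge0_ler_powR; rewrite ?nnegrE ?subr_ge0//; lra.
  by rewrite -subr_gt0.
Qed.

Lemma cvg_lpush_Z {R : realType} (a b g phi : R) (u : nat -> R) :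
  0 < a -> 0 < b -> 0 <= g -> 0 <= phi <= 1 -> (forall n, 0 <= u n <= 1) ->
  u n @[n --> \oo] --> phi ->
  lpush_Z a b g (u n) @[n --> \oo] --> lpush_Z a b g phi.
Proof.
move=> a0 b0 g0 phi01 u01 cu.
have oo01 (t : R) : (`]0, 1[%classic : set R) t -> 0 < t < 1.
  by rewrite /= in_itv.
apply: fine_cvg; rewrite /lpush_Z /Rintegral fineK; last first.
  by apply: integrable_fin_num => //; exact: integrable_lpush_kernel.
apply: (@dominated_cvg _ _ _ mu _ (measurable_itv _) _ _
  (EFin \o beta_kernel a b)) => //.
- by move=> n; apply/measurable_EFinP; exact: measurable_lpush_kernel.
- move=> t /oo01 t01; apply: cvg_EFin; first exact: nearW.
  have [h _ _] := onem_mul_itv t01 phi01.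
  apply: cvgMl_tmp; apply: (@cvg_comp _ _ _ (fun n => 1 - t * u n)
      (@powR R ^~ g) _ (nbhs (1 - t * phi))).
    by apply: cvgB; [exact: cvg_cst|exact: cvgMl_tmp].
  by apply: (@derivable1_continuous _ (@powR R ^~ g)); have [] := is_derive1_powR g h.
- exact: integrable_beta_kernel.
- move=> n t /oo01 t01; rewrite lee_fin (ger0_norm (lpush_kernel_ge0 _ _ _ _ _)).
  exact: lpush_kernel_le.
Qed.

(** Writing the slope of the logarithm as an exact factor 1 / z with z near x replaces the chain
    rule where the inner slope tends to infinity. *)
Lemma ln_slope {R : realType} (x y : R) : 0 < x -> 0 < y ->
  exists z, [/\ 0 < z, `|z - x| <= `|y - x| & ln y - ln x = z^-1 * (y - x)].
Proof.
move=> x0 y0.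
pose lo := Num.min x y; pose hi := Num.max x y.
have xI : lo <= x <= hi by rewrite /lo /hi ge_min le_max lexx.
have yI : lo <= y <= hi by rewrite /lo /hi ge_min le_max lexx !orbT.
have lo0 : 0 < lo by rewrite lt_min x0.
have [c cI e] := @MVT_between _ (@ln R) (fun z => z^-1) lo hi x y xI yI
  (fun z zI => is_derive1_ln (lt_le_trans lo0 (andP zI).1)).
exists c; split=> //; first by case/andP: cI => + _; exact: lt_le_trans.
move: cI; rewrite /lo /hi; have [xy|yx] := leP x y.
  rewrite ?(min_idPl xy) ?(max_idPr xy) => /andP[xc cy].
  by rewrite !ger0_norm ?subr_ge0// lerD2r.
rewrite ?(min_idPr (ltW yx)) ?(max_idPl (ltW yx)) => /andP[yc cx].
by rewrite !ler0_norm ?subr_le0 ?(ltW yx)// lerN2 lerD2r.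
Qed.

(** The slope of log Z is the slope of Z times 1 / z n, where z n tends to Z(phi) by continuity of
    Z. *)
Lemma has_derivative_in_lnZ_phi {R : realType} (a b g phi : R) :
  0 < a -> 0 < b -> 0 <= g -> 0 <= phi <= 1 ->
  has_derivative_in `[0, 1] (fun p => - ln (lpush_Z a b g p)) phi
    (g%:E * (\int[mu]_(t in `]0%R, 1%R[)
      (beta_kernel (a + 1) b t * (1 - t * phi) `^ (g - 1))%:E /
      (lpush_Z a b g phi)%:E))%E.
Proof.
move=> a0 b0 g0 phi01; have /andP[phi_ge0 phi_le1] := phi01.
have Z0 := lpush_Z_gt0 a0 b0 g0 phi01.
(* For phi < 1, [hi] is the midpoint of phi and 1, so the bounds near phi avoid 1; for phi = 1 it is
   1 itself. *)
have [hi [hi1 phihi hicase [e e0 ehi]]] : exists hi : R,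
    [/\ hi <= 1, phi <= hi, hi < 1 \/ phi = 1 & exists2 e, 0 < e &
    forall y : R, y <= 1 -> `|y - phi| < e -> y <= hi].
  have [phi1|phi1] := ltP phi 1.
    exists ((1 + phi) / 2); split; [lra|lra|left; lra|].
    exists ((1 - phi) / 2); first lra.
    by move=> y _ ; rewrite ltr_norml => /andP[_ h]; lra.
  exists 1; split=> //; first by right; apply/eqP; rewrite eq_le phi_le1.
  by exists 1.
apply: (cvg_within_dnbhs_seq e0) => u hu cu.
have u01 n : 0 <= u n <= 1 by have [+ _ _] := hu n; rewrite /= in_itv.
have u_neq n : u n != phi by have [] := hu n.
have u_hi n : 0 <= u n <= hi.
  have /andP[h0 h1] := u01 n; rewrite h0; apply: ehi => //.
  by have [] := hu n.
have phi_hi : 0 <= phi <= hi by rewrite phi_ge0.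
have slopes := cvg_lpush_Z_slope a0 b0 g0 hi1 phi_hi hicase u_hi u_neq cu.
have cZ := cvg_lpush_Z a0 b0 g0 phi01 u01 cu.
have exz n : exists z, [/\ 0 < z,
    `|z - lpush_Z a b g phi| <= `|lpush_Z a b g (u n) - lpush_Z a b g phi| &
    ln (lpush_Z a b g (u n)) - ln (lpush_Z a b g phi) =
    z^-1 * (lpush_Z a b g (u n) - lpush_Z a b g phi)].
  exact: ln_slope Z0 (lpush_Z_gt0 a0 b0 g0 (u01 n)).
have [z hz] := choice exz.
have cz : z n @[n --> \oo] --> lpush_Z a b g phi.
  apply/subr_cvg0/norm_cvg0P; apply: (@squeeze_cvgr _ _ _ _ (fun=> 0)
    (fun n => `|lpush_Z a b g (u n) - lpush_Z a b g phi|)).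
  - by apply: nearW => n; rewrite normr_ge0; have [_ ->] := hz n.
  - exact: cvg_cst.
  - by apply/norm_cvg0P/subr_cvg0.
have czV : (z n)^-1%:E @[n --> \oo] --> (lpush_Z a b g phi)^-1%:E.
  by apply: cvg_EFin; [exact: nearW|apply: cvgV => //; rewrite gt_eqF].
rewrite (_ : (fun n => _) = (fun n => (z n)^-1%:E * (- ((lpush_Z a b g (u n) -
    lpush_Z a b g phi) / (u n - phi)))%:E)%E); last first.
  apply/funext => n; rewrite -EFinM; congr EFin; have [_ _ h] := hz n.
  by rewrite -opprD h mulNr mulrN mulrA.
rewrite (_ : (g%:E * _)%E = ((lpush_Z a b g phi)^-1%:E * (g%:E *
  \int[mu]_(t in `]0%R, 1%R[)
      (beta_kernel (a + 1) b t * (1 - t * phi) `^ (g - 1))%:E))%E); last first.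
  by rewrite inver gt_eqF// muleA [RHS]muleC.
apply: cvgeM => //.
(* The product of limits is never 0 times infinity, because 1 / Z(phi) is finite and nonzero. *)
by move: (g%:E * _)%E => -[r| |] //=; rewrite invr_neq0// gt_eqF.
Qed.

(** * Expectations and the score function *)

(** [h] has the same integral over each measurable set as the Radon-Nikodym derivative of [nu],
    hence equals it almost everywhere, and the change of variables carries over. *)
Lemma ge0_integral_density {R : realType} d (T : measurableType d)
    (mu : {sigma_finite_measure set T -> \bar R})
    (nu : {finite_measure set T -> \bar R}) (h : T -> R) :
  measurable_fun setT h -> (forall x, 0 <= h x) ->
  (forall A, measurable A -> nu A = (\int[mu]_(x in A) (h x)%:E)%E) ->
  forall f : T -> \bar R, measurable_fun setT f -> (forall x, (0 <= f x)%E) ->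
  (\int[nu]_x f x = \int[mu]_x (f x * (h x)%:E))%E.
Proof.
move=> mh h0 nuE f mf f0.
have mhE (D : set T) : measurable_fun D (fun x => (h x)%:E).
  by apply/measurable_EFinP; exact: measurable_funTS.
have dom : nu `<< mu.
  apply/null_content_dominatesP => A mA A0; rewrite nuE//.
  exact: null_set_integral.
rewrite -(Radon_Nikodym_SigmaFinite.change_of_variables dom)//.
have mRN : measurable_fun setT (Radon_Nikodym_SigmaFinite.f nu mu).
  exact: measurable_int (Radon_Nikodym_SigmaFinite.f_integrable dom).
apply: ae_eq_integral => //; [exact: emeasurable_funM..|].
apply: ae_eqe_mul2l; apply: integral_ae_eq => //.
- exact: Radon_Nikodym_SigmaFinite.f_integrable.
- move=> E _ mE; rewrite -nuE//.
  by rewrite -Radon_Nikodym_SigmaFinite.f_integral.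
Qed.

(** Since [h >= 0], multiplication by it commutes with taking positive and negative parts. *)
Lemma integral_density {R : realType} d (T : measurableType d)
    (mu : {sigma_finite_measure set T -> \bar R})
    (nu : {finite_measure set T -> \bar R}) (h : T -> R) :
  measurable_fun setT h -> (forall x, 0 <= h x) ->
  (forall A, measurable A -> nu A = (\int[mu]_(x in A) (h x)%:E)%E) ->
  forall f : T -> \bar R, measurable_fun setT f ->
  (\int[nu]_x f x = \int[mu]_x (f x * (h x)%:E))%E.
Proof.
move=> mh h0 nuE f mf; rewrite integralE [RHS]integralE.
rewrite !(ge0_integral_density mh h0 nuE)//; last 2 first.
- exact: measurable_funeneg.
- exact: measurable_funepos.
congr (_ - _)%E; apply: eq_integral => x _.
  by rewrite !funeposE maxe_pMl ?lee_fin// mul0e.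
by rewrite !funenegE maxe_pMl ?lee_fin// mul0e mulNe.
Qed.

Lemma lpush_pdfE {R : realType} (a b g p : R) :
  lpush_pdf a b g p =
  (fun x => lpush_kernel a b g p x / lpush_Z a b g p) \_ `[0, 1].
Proof.
apply/funext => x; rewrite /lpush_pdf patchE lpush_ZE.
have [x01|x01] := boolP (0 <= x <= 1); first by rewrite mem_set//= in_itv.
by rewrite memNset//= in_itv/=; exact/negP.
Qed.

Lemma measurable_lpush_pdf {R : realType} (a b g p : R) :
  measurable_fun setT (lpush_pdf a b g p).
Proof.
rewrite lpush_pdfE; apply/(measurable_restrictT _ (measurable_itv _)).
by apply: measurable_funM => //; exact: measurable_lpush_kernel.
Qed.

Lemma expectation_lpush {R : realType} (a b g p : R) d (T : measurableType d)
    (Q : probability T R) (X : {RV Q >-> R}) (f : R -> R) :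
  0 < a -> 0 < b -> 0 <= g -> 0 <= p <= 1 ->
  lpush_distributed X a b g p -> measurable_fun setT f ->
  mu.-integrable `]0, 1[ (EFin \o (fun t => f t * lpush_kernel a b g p t)) ->
  fine ('E_Q[fun w => f (X w)])%E =
  (\int[mu]_(t in `]0%R, 1%R[) (f t * lpush_kernel a b g p t)) /
    lpush_Z a b g p.
Proof.
move=> a0 b0 g0 p01 dX mf intf.
have Z0 := lpush_Z_gt0 a0 b0 g0 p01.
have mpdf := measurable_lpush_pdf a b g p.
have pdf0 x : 0 <= lpush_pdf a b g p x.
  rewrite lpush_pdfE patchE; case: ifP => // _.
  by rewrite divr_ge0 ?lpush_kernel_ge0// ltW.
have mfE : measurable_fun setT (EFin \o f) by exact/measurable_EFinP.
have -> : ('E_Q[fun w => f (X w)] =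
    \int[mu]_x ((f x)%:E * (lpush_pdf a b g p x)%:E))%E.
  (* [X] is repackaged with values in [measurableTypeR R], so that its law and Lebesgue measure live
     on the same measurable type. *)
  have mX : measurable_fun setT (X : T -> measurableTypeR R).
    by move=> _ B mB; exact: (@measurable_funPT _ _ _ _ X measurableT B mB).
  pose X' : {RV Q >-> measurableTypeR R} :=
    HB.pack (X : T -> measurableTypeR R) (isMeasurableFun.Build _ _ _ _ _ mX).
  rewrite -(@integral_density R _ (measurableTypeR R) lebesgue_measure
    (distribution Q X') _ mpdf pdf0 dX _ mfE).
  rewrite unlock integralE [RHS]integralE; congr (_ - _)%E.
  - rewrite ge0_integral_distribution//; last exact: measurable_funepos.
    by apply: eq_integral => w _; rewrite /= !funeposE.
  - rewrite ge0_integral_distribution//; last exact: measurable_funeneg.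
    by apply: eq_integral => w _; rewrite /= !funenegE.
have -> : (\int[mu]_x ((f x)%:E * (lpush_pdf a b g p x)%:E) =
    \int[mu]_(t in `]0%R, 1%R[)
      ((lpush_Z a b g p)^-1 * (f t * lpush_kernel a b g p t))%:E)%E.
  rewrite -(@integral_itv_bndoo _ _ _ _ true false); last first.
    apply/measurable_EFinP; apply: measurable_funM => //.
    by apply: measurable_funM; [exact: measurable_funTS|exact: measurable_lpush_kernel].
  rewrite [RHS]integral_mkcond; apply: eq_integral => x _.
  rewrite lpush_pdfE !patchE -EFinM; case: ifP => _; last by rewrite mulr0.
  by congr EFin; ring.
rewrite mulrC -RintegralZl//.
Qed.

Lemma integral_lpush_kernel {R : realType} (a b g p : R) :
  0 < a -> 0 < b -> 0 <= g -> 0 <= p <= 1 ->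
  (\int[mu]_(t in `]0%R, 1%R[) (beta_kernel a b t * (1 - t * p) `^ g)%:E =
  (lpush_Z a b g p)%:E)%E.
Proof.
move=> a0 b0 g0 p01; rewrite /lpush_Z /Rintegral fineK//.
by apply: integrable_fin_num => //; exact: integrable_lpush_kernel.
Qed.

(** * The log-likelihood and its derivatives *)

Lemma lpush_loglikE {R : realType} n (x : 'I_n -> R) (a b g p : R) :
  (forall i, 0 < x i < 1) -> 0 < a -> 0 < b -> 0 <= g -> 0 <= p <= 1 ->
  lpush_loglik x a b g p =
  (a - 1) * \sum_(i < n) ln (x i) + (b - 1) * \sum_(i < n) ln (1 - x i) +
  g * \sum_(i < n) ln (1 - x i * p) - n%:R * ln (lpush_Z a b g p).
Proof.
move=> x01 a0 b0 g0 p01; have Z0 := lpush_Z_gt0 a0 b0 g0 p01.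
rewrite /lpush_loglik (eq_bigr (fun i => (a - 1) * ln (x i) +
  (b - 1) * ln (1 - x i) + g * ln (1 - x i * p) - ln (lpush_Z a b g p))).
  by rewrite sumrB !big_split/= -!mulr_sumr sumr_const card_ord mulr_natl.
move=> i _; have /andP[xi0 xi1] := x01 i; have [h _ _] := onem_mul_itv (x01 i) p01.
rewrite lpush_pdfE patchE mem_set/=; last by rewrite in_itv/= !ltW.
rewrite ln_div ?posrE ?lpush_kernel_gt0// /lpush_kernel.
by rewrite !lnM ?posrE ?mulr_gt0 ?powR_gt0 ?subr_gt0// ?ln_powR// -subr_gt0.
Qed.

(** The shape of the log-likelihood in one exponent: c = 1 for alpha and beta, c = 0 for gamma. The
    quotient dZ / Z is the expected logarithm. *)
Lemma is_derive_affine_lnZ {R : realType} (Z : R -> R) (A B c m r dZ : R) :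
  is_derive r 1 Z dZ -> 0 < Z r ->
  is_derive r 1 (fun s => (s - c) * A + B - m * ln (Z s)) (A - m * (dZ / Z r)).
Proof.
move=> h Z0; have hl := @is_derive1_comp _ (@ln R) Z r _ _ (is_derive1_ln Z0) h.
rewrite (_ : (fun s => _) = (fun s => (s - c) * A + B - m * (@ln R \o Z) s))//.
by apply: is_derive_eq; rewrite /GRing.scale/=; ring.
Qed.

(** As x i < 1, the numbers 1 - x i p stay positive up to p = 1, so the data part has a two-sided
    derivative even at the end points. *)
Lemma is_derive_sum_ln_affine {R : realType} n (x : 'I_n -> R) (C g p : R) :
  (forall i, 0 < x i < 1) -> 0 <= p <= 1 ->
  is_derive p 1 (fun q => C + g * \sum_(i < n) ln (1 - x i * q))
    (- \sum_(i < n) (g * x i / (1 - x i * p))).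
Proof.
move=> x01 p01.
have hi i : is_derive p 1 (fun q => ln (1 - x i * q)) (- (x i / (1 - x i * p))).
  have [h _ _] := onem_mul_itv (x01 i) p01.
  have ha : is_derive p 1 (fun q => 1 - x i * q) (- x i).
    by apply: is_derive_eq; rewrite /GRing.scale/=; ring.
  have := @is_derive1_comp _ (@ln R) (fun q => 1 - x i * q) p _ _
    (is_derive1_ln h) ha.
  by rewrite mulrN mulrC.
rewrite (_ : (fun q => _) = cst C + g *: \sum_(i < n) (fun q => ln (1 - x i * q))).
  have hs := is_derive_sum hi.
  have -> : - \sum_(i < n) (g * x i / (1 - x i * p)) =
      0 + g *: \sum_(i < n) - (x i / (1 - x i * p)).
    rewrite add0r sumrN scalerN scaler_sumr; congr (- _).
    by apply: eq_bigr => i _; rewrite /GRing.scale/= mulrA.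
  exact: is_deriveD (is_derive_cst _ _ _) (is_deriveZ g hs).
by apply/funext => q; rewrite !fctE fct_sumE.
Qed.

(** Euler's integral twice: with c = 1 - g above, possibly infinite, and with c = - g below, where
    it is the finite Z. *)
Lemma lpush_score_phiE {R : realType} (a b g p : R) :
  0 < a -> 0 < b -> 0 <= g -> 0 <= p <= 1 ->
  ((Beta (a + 1) b)%:E * hypergeo2F1 (1 - g) (a + 1) (a + b + 1) p /
    ((Beta a b)%:E * hypergeo2F1 (- g) a (a + b) p) =
  \int[mu]_(t in `]0%R, 1%R[)
    (beta_kernel (a + 1) b t * (1 - t * p) `^ (g - 1))%:E /
    (lpush_Z a b g p)%:E)%E.
Proof.
move=> a0 b0 g0 p01; rewrite (addrAC a b 1) !Euler_integral ?addr_gt0//.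
by rewrite (opprB 1 g) (opprK g) (integral_lpush_kernel a0 b0 g0 p01).
Qed.

(** Boundary values are covered: the derivative is one-sided at gamma = 0 and at phi = 0 or 1. The
    phi-derivative is extended-real, since the integral in its numerator diverges at phi = 1 when
    beta + gamma <= 1. *)
Theorem mainTheorem16 (R : realType) (alpha beta gamma phi : R)
    (halpha : 0 < alpha) (hbeta : 0 < beta) (hgamma : 0 <= gamma)
    (hphi : 0 <= phi <= 1)
    (n : nat)
    (d : measure_display) (T : measurableType d) (P : probability T R)
    (X : 'I_n -> {RV P >-> R})
    (hX : lpush_iid X alpha beta gamma phi)
    (w : T) (x : 'I_n -> R)
    (hx : forall i, x i = X i w)
    (hx01 : forall i, 0 < x i < 1)
    (d' : measure_display) (T' : measurableType d') (Q : probability T' R)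
    (XL : {RV Q >-> R})
    (hXL : lpush_distributed XL alpha beta gamma phi) :
  [/\ lpush_loglik x alpha beta gamma phi =
        (alpha - 1) * \sum_(i < n) ln (x i)
        + (beta - 1) * \sum_(i < n) ln (1 - x i)
        + gamma * \sum_(i < n) ln (1 - x i * phi)
        - \sum_(i < n) ln (\int[lebesgue_measure]_(t in `[0, 1])
            (t `^ (alpha - 1) * (1 - t) `^ (beta - 1)
             * (1 - t * phi) `^ gamma)),
      is_derive alpha 1 (fun a => lpush_loglik x a beta gamma phi)
        (\sum_(i < n) ln (x i) - n%:R * lpush_L1 XL),
      is_derive beta 1 (fun b => lpush_loglik x alpha b gamma phi)
        (\sum_(i < n) ln (1 - x i) - n%:R * lpush_L2 XL),
      has_derivative_in `[0, +oo[
        (fun g => lpush_loglik x alpha beta g phi) gamma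
        (\sum_(i < n) ln (1 - x i * phi) - n%:R * lpush_L3 XL phi)%:E
    & has_derivative_in `[0, 1]
        (fun p => lpush_loglik x alpha beta gamma p) phi
        ((- \sum_(i < n) (gamma * x i / (1 - x i * phi)))%:E
         + (n%:R * gamma)%:E
           * ((Beta (alpha + 1) beta)%:E
                * hypergeo2F1 (1 - gamma) (alpha + 1) (alpha + beta + 1) phi
              / ((Beta alpha beta)%:E
                * hypergeo2F1 (- gamma) alpha (alpha + beta) phi)))%E ].
Proof.
have Z0 := lpush_Z_gt0 halpha hbeta hgamma hphi.
split.
- rewrite (lpush_loglikE hx01 halpha hbeta hgamma hphi); congr (_ - _).
  by rewrite lpush_ZE sumr_const card_ord mulr_natl.
- have [int_ln dZ] := is_derive_lpush_Z_alpha halpha hbeta hgamma hphi.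
  rewrite /lpush_L1 (@expectation_lpush _ alpha beta gamma phi _ _ _ XL (@ln R))//.
  have := is_derive_affine_lnZ (\sum_(i < n) ln (x i))
    ((beta - 1) * \sum_(i < n) ln (1 - x i) +
     gamma * \sum_(i < n) ln (1 - x i * phi)) 1 n%:R dZ Z0.
  (* The closed form needs a positive first parameter, which holds near alpha. *)
  apply: near_eq_is_derive; near=> a.
  have a0 : 0 < a by near: a; exact: lt_nbhsr.
  by rewrite (lpush_loglikE hx01 a0 hbeta hgamma hphi) addrA.
- have [int_ln dZ] := is_derive_lpush_Z_beta halpha hbeta hgamma hphi.
  rewrite /lpush_L2 (@expectation_lpush _ alpha beta gamma phi _ _ _ XL
    (fun t => ln (1 - t)))//; last first.
    apply: (measurableT_comp (@measurable_ln R)).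
    exact: measurable_funB.
  have := is_derive_affine_lnZ (\sum_(i < n) ln (1 - x i))
    ((alpha - 1) * \sum_(i < n) ln (x i) +
     gamma * \sum_(i < n) ln (1 - x i * phi)) 1 n%:R dZ Z0.
  apply: near_eq_is_derive; near=> b.
  have b0 : 0 < b by near: b; exact: lt_nbhsr.
  by rewrite (lpush_loglikE hx01 halpha b0 hgamma hphi); ring.
- have [int_ln dZ] := is_derive_lpush_Z_gamma halpha hbeta hgamma hphi.
  rewrite /lpush_L3 (@expectation_lpush _ alpha beta gamma phi _ _ _ XL
    (fun t => ln (1 - t * phi)))//; last first.
    apply: (measurableT_comp (@measurable_ln R)).
    exact: measurable_affine.
  have dl := is_derive_affine_lnZ (\sum_(i < n) ln (1 - x i * phi))
    ((alpha - 1) * \sum_(i < n) ln (x i) +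
     (beta - 1) * \sum_(i < n) ln (1 - x i)) 0 n%:R dZ Z0.
  (* Only the values at g >= 0 enter, where the closed form of the log-likelihood is available. *)
  apply: (has_derivative_in_eq _ _ (is_derive_has_derivative_in _ dl)).
    by rewrite /= in_itv/= hgamma.
  move=> g; rewrite /= in_itv/= andbT => g0.
  by rewrite (lpush_loglikE hx01 halpha hbeta g0 hphi); ring.
- rewrite lpush_score_phiE// EFinM -muleA.
  pose C := (alpha - 1) * \sum_(i < n) ln (x i) +
    (beta - 1) * \sum_(i < n) ln (1 - x i).
  (* The derivative splits into a finite data part and n times that of - log Z, which may be
     infinite. *)
  have d1 := @is_derive_has_derivative_in _ `[0, 1] _ _ _
    (is_derive_sum_ln_affine C gamma hx01 hphi).
  have d2 := @has_derivative_inZ _ _ _ _ n%:R _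
    (has_derivative_in_lnZ_phi halpha hbeta hgamma hphi).
  apply: (has_derivative_in_eq _ _ (has_derivative_inD d1 d2)).
    by rewrite /= in_itv.
  move=> p; rewrite /= in_itv/= => p01.
  by rewrite (lpush_loglikE hx01 halpha hbeta hgamma p01) mulrN.
Unshelve. all: by end_near. Qed.
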